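(* Let $R$ be a $k$-algebra, let $(H,s_H,t_H,\Delta_H,\epsilon_H)$ be an $R$-bialgebroid, and let $(H,A,C)_R$ be a left-left Doi-Koppinen datum over $R$. Then $\mathcal C=C\otimes_RA$ is an $A$-bimodule with the right action given by the multiplication in $A$ and the left action $$a\cdot(c\otimes_Ra')=a_{<-1>}\cdot c\otimes_Ra_{<0>}a',\qquad a,a'\in A,\ c\in C.$$ Furthermore, $\mathcal C$ is an $A$-coring with comultiplication $\Delta_{\mathcal C}=\Delta_C\otimes_RA$ and counit $\epsilon_{\mathcal C}=\epsilon_C\otimes_RA$, where $\Delta_C,\epsilon_C$ are the coproduct and the counit of the $R$-coring $C$, and where the natural isomorphisms $(C\otimes_RA)\otimes_A(C\otimes_RA)\cong C\otimes_RC\otimes_RA$ and $R\otimes_RA\cong A$ are used. In this case the category of left $\mathcal C$-comodules and the category ${}^C_A\mathcal M(H;R)$ of left-left Doi-Koppinen modules over $R$ associated to $(H,A,C)_R$ are isomorphic to each other.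
   Context: Conventions. $k$ is a commutative ring with unit; all algebras are unital $k$-algebras, $\otimes=\otimes_k$, modules are unital; in tensor products of maps, an object denotes its identity map. Sweedler notation: $\Delta(c)=c_{(1)}\otimes c_{(2)}$ for coproducts, ${}^M\rho(m)=m_{<-1>}\otimes m_{<0>}$ for left coactions (summation understood). $\bar R=R^{op}$, $R^e=R\otimes\bar R$. Corings. For an algebra $B$, a $B$-coring is a coalgebra in the monoidal category of $B$-bimodules $({}_B\mathcal M_B,\otimes_B,B)$. A left comodule of a $B$-coring $\mathcal C$ is a left $B$-module $M$ with a left $B$-linear map ${}^M\rho:M\to\mathcal C\otimes_BM$ that is coassociative and counital; morphisms are left $B$-linear maps commuting with coactions. Bialgebroids. An $R$-ring is a pair $(U,i)$ with $U$ an algebra and $i:R\to U$ an algebra map. An $R^e$-ring is given by $(H,s_H,t_H)$ with $s_H:R\to H$, $t_H:\bar R\to H$ algebra maps with commuting images; $H$ is an $R$-bimodule by $r\cdot h\cdot r'=s_H(r)t_H(r')h$. For an $R$-ring $(A,s_A)$, viewed as an $R$-bimodule via $s_A$, $$H\times_R A=\Big\{\sum_i h^i\otimes_R a^i\in H\otimes_R A\;\Big|\;\sum_i h^it_H(r)\otimes_R a^i=\sum_i h^i\otimes_R a^is_A(r)\ \ \forall r\in R\Big\},$$ an algebra with componentwise product and unit $1_H\otimes_R1_A$; $H\times_RH$ is the case $(A,s_A)=(H,s_H)$. An $R$-bialgebroid is an $R^e$-ring $(H,s_H,t_H)$ with an $R$-coring structure $(H,\Delta_H,\epsilon_H)$ such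 that $\mathrm{Im}\,\Delta_H\subseteq H\times_RH$, $\Delta_H:H\to H\times_RH$ is an algebra map, $\epsilon_H(1_H)=1_R$, and $\epsilon_H(gh)=\epsilon_H(gs_H(\epsilon_H(h)))=\epsilon_H(gt_H(\epsilon_H(h)))$ for all $g,h\in H$. Doi-Koppinen data over $R$. A left $H$-comodule algebra is a triple $(A,s_A,{}^A\rho)$ such that $(A,s_A)$ is an $R$-ring, $(A,{}^A\rho)$ is a left comodule of the $R$-coring $H$ (with $A$ a left $R$-module via $s_A$), $\mathrm{Im}({}^A\rho)\subseteq H\times_RA$ and ${}^A\rho:A\to H\times_RA$ is an algebra map. A left $H$-module coalgebra is a coalgebra in the monoidal category $({}_H\mathcal M,\otimes_R,R)$ (with $h\cdot(m\otimes_Rn)=h_{(1)}\cdot m\otimes_Rh_{(2)}\cdot n$ and $h\triangleright a=\epsilon_H(hs_H(a))=\epsilon_H(ht_H(a))$ on $R$); equivalently a left $H$-module $C$ with an $R$-coring structure $(C,\Delta_C,\epsilon_C)$, where $r\cdot c\cdot r'=s_H(r)t_H(r')\cdot c$, such that $\Delta_C(h\cdot c)=h_{(1)}\cdot c_{(1)}\otimes_Rh_{(2)}\cdot c_{(2)}$ and $\epsilon_C(h\cdot c)=\epsilon_H(hs_H(\epsilon_C(c)))$. A left-left Doi-Koppinen datum over $R$, denoted $(H,A,C)_R$, consists of an $R$-bialgebroid $H$, a left $H$-comodule algebra $A$ and a left $H$-module coalgebra $C$. A left-left Doi-Koppinen module over $R$ associated to $(H,A,C)_R$ is a left $A$-module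 $M$ (hence a left $R$-module via $s_A$) that is a left comodule of the $R$-coring $C$ via ${}^M\rho:M\to C\otimes_RM$, with ${}^M\rho(a\cdot m)=a_{<-1>}\cdot m_{<-1>}\otimes_Ra_{<0>}\cdot m_{<0>}$ for all $a\in A$, $m\in M$; morphisms are left $A$-linear left $C$-colinear maps. Their category is ${}^C_A\mathcal M(H;R)$. *)

(* Defs.v *)
From HB Require Import structures.
From mathcomp Require Import all_boot all_order all_algebra.
From mathcomp Require Import boolp.

Set Implicit Arguments.
Unset Strict Implicit.
Unset Printing Implicit Defensive.

Import GRing.Theory.
Local Open Scope ring_scope.
Local Open Scope quotient_scope.

(* Tensor product over a possibly noncommutative ring.  A right S-module is
   presented by its underlying abelian group M and its action
   ra : M -> S -> M, a left S-module by N and la : S -> N -> N, so that one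
   abelian group may carry several module structures.  M (x)_S N is the set of
   formal sums of pairs (m, n) modulo the congruence generated by the bilinearity
   and balancing relations; formal opposites are not needed because
   - (m (x) n) = (- m) (x) n. *)

Section Tensor.
Variables (S : Type) (M N : zmodType) (ra : M -> S -> M) (la : S -> N -> N).

Inductive tensor_eq : seq (M * N) -> seq (M * N) -> Prop :=
| TensorRefl x : tensor_eq x x
| TensorSym x y : tensor_eq x y -> tensor_eq y x
| TensorTrans x y z : tensor_eq x y -> tensor_eq y z -> tensor_eq x z
| TensorCat x x' y y' :
    tensor_eq x x' -> tensor_eq y y' -> tensor_eq (x ++ y) (x' ++ y')
| TensorComm x y : tensor_eq (x ++ y) (y ++ x)
| TensorDl m m' n : tensor_eq [:: (m + m', n)] [:: (m, n); (m', n)]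
| TensorDr m n n' : tensor_eq [:: (m, n + n')] [:: (m, n); (m, n')]
| Tensor0 n : tensor_eq [:: (0, n)] [::]
| TensorBal m s n : tensor_eq [:: (ra m s, n)] [:: (m, la s n)].

Definition tensor_eqb : rel (seq (M * N)) := fun x y => `[< tensor_eq x y >].

Fact tensor_eqb_refl : reflexive tensor_eqb.
Proof. by move=> x; apply/asboolP; exact: TensorRefl. Qed.

Fact tensor_eqb_sym : symmetric tensor_eqb.
Proof. by move=> x y; apply/asboolP/asboolP; exact: TensorSym. Qed.

Fact tensor_eqb_trans : transitive tensor_eqb.
Proof.
move=> y x z /asboolP xy /asboolP yz; apply/asboolP; exact: TensorTrans xy yz.
Qed.

Definition tensor_equiv :=
  EquivRel tensor_eqb tensor_eqb_refl tensor_eqb_sym tensor_eqb_trans.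

Definition tensor : Type := {eq_quot tensor_equiv}.
HB.instance Definition _ := Choice.on tensor.

Definition tensor_pi (x : seq (M * N)) : tensor := \pi_({eq_quot tensor_equiv}) x.
Definition tensor_repr (x : tensor) : seq (M * N) :=
  repr (x : {eq_quot tensor_equiv}).

Lemma tensor_reprK x : tensor_pi (tensor_repr x) = x.
Proof. exact: reprK. Qed.

Lemma tensor_piP x y : tensor_eq x y <-> tensor_pi x = tensor_pi y.
Proof.
have e : reflect (tensor_pi x = tensor_pi y) (x == y %[mod {eq_quot tensor_equiv}]).
  exact: eqP.
by rewrite eqmodE in e; split=> [xy|/e/asboolP//]; apply/e/asboolP.
Qed.

Lemma tensor_piK x : tensor_eq (tensor_repr (tensor_pi x)) x.
Proof. by apply/tensor_piP; rewrite tensor_reprK. Qed.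

Definition tensor_add (x y : tensor) : tensor :=
  tensor_pi (tensor_repr x ++ tensor_repr y).
Definition tensor_zero : tensor := tensor_pi [::].
Definition tensor_opp (x : tensor) : tensor :=
  tensor_pi [seq (- p.1, p.2) | p <- tensor_repr x].

Lemma tensor_addE x y : tensor_add (tensor_pi x) (tensor_pi y) = tensor_pi (x ++ y).
Proof. by apply/tensor_piP/TensorCat; exact: tensor_piK. Qed.

Fact tensor_addA : associative tensor_add.
Proof.
move=> x y z; rewrite -[x]tensor_reprK -[y]tensor_reprK -[z]tensor_reprK.
by rewrite !tensor_addE catA.
Qed.

Fact tensor_addC : commutative tensor_add.
Proof. by move=> x y; apply/tensor_piP/TensorComm. Qed.

Fact tensor_add0 : left_id tensor_zero tensor_add.
Proof. by move=> x; rewrite -[x]tensor_reprK tensor_addE. Qed.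

HB.instance Definition _ :=
  GRing.isNmodule.Build tensor tensor_addA tensor_addC tensor_add0.

Lemma tensor_piD x y : tensor_pi (x ++ y) = tensor_pi x + tensor_pi y.
Proof. by rewrite -tensor_addE. Qed.

Fact tensor_addN : left_inverse 0 tensor_opp +%R.
Proof.
move=> x; rewrite -[x in _ + x]tensor_reprK /tensor_opp.
elim: (tensor_repr x) => [|[m n] s IHs] /=; first by rewrite -tensor_piD.
rewrite -cat1s -(cat1s (m, n) s) !tensor_piD addrACA IHs addr0 -tensor_piD.
apply/tensor_piP/(TensorTrans _ (Tensor0 n))/TensorSym.
by rewrite -(addNr m); exact: TensorDl.
Qed.

HB.instance Definition _ := GRing.Nmodule_isZmodule.Build tensor tensor_addN.

Definition tens (m : M) (n : N) : tensor := tensor_pi [:: (m, n)].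

Lemma tensDl m m' n : tens (m + m') n = tens m n + tens m' n.
Proof. by rewrite -tensor_piD; apply/tensor_piP/TensorDl. Qed.

Lemma tensDr m n n' : tens m (n + n') = tens m n + tens m n'.
Proof. by rewrite -tensor_piD; apply/tensor_piP/TensorDr. Qed.

Lemma tens_bal m s n : tens (ra m s) n = tens m (la s n).
Proof. by apply/tensor_piP/TensorBal. Qed.

Lemma tens_sum (x : tensor) : x = \sum_(p <- tensor_repr x) tens p.1 p.2.
Proof.
rewrite -[LHS]tensor_reprK; elim: (tensor_repr x) => [|[m n] s IHs].
  by rewrite big_nil.
by rewrite big_cons -IHs -tensor_piD.
Qed.

Lemma tensor_ind (P : tensor -> Prop) :
  P 0 -> (forall m n, P (tens m n)) -> (forall x y, P x -> P y -> P (x + y)) ->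
  forall x, P x.
Proof.
move=> P0 Pt PD x; rewrite (tens_sum x).
by elim/big_rec: _ => // p y _ Py; exact: PD.
Qed.

Section Lift.
Variables (P : zmodType) (f : M -> N -> P).

Record balanced : Prop := Balanced {
  balancedDl : forall m m' n, f (m + m') n = f m n + f m' n;
  balancedDr : forall m n n', f m (n + n') = f m n + f m n';
  balanced_bal : forall m s n, f (ra m s) n = f m (la s n) }.

(* The map m (x) n |-> f m n.  It is computed on a chosen representative, so as
   to be total in f; it is only used for families f that are balanced, and then
   tlift_tens and tliftD characterize it. *)
Definition tlift (x : tensor) : P := \sum_(p <- tensor_repr x) f p.1 p.2.

Hypothesis f_bal : balanced.

Lemma tlift_eq x y : tensor_eq x y ->
  \sum_(p <- x) f p.1 p.2 = \sum_(p <- y) f p.1 p.2.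
Proof.
elim=> {x y} [//|x y _ -> //|x y z _ -> _ -> //|x x' y y' _ e _ e'|x y|||n|].
- by rewrite !big_cat /= e e'.
- by rewrite !big_cat /= addrC.
- by move=> m m' n; rewrite !big_cons !big_nil !addr0 balancedDl.
- by move=> m n n'; rewrite !big_cons !big_nil !addr0 balancedDr.
- rewrite big_cons !big_nil addr0 /=; apply: (@addIr _ (f 0 n)).
  by rewrite -balancedDl // !add0r.
- by move=> m s n; rewrite !big_cons !big_nil balanced_bal.
Qed.

Lemma tlift_tens m n : tlift (tens m n) = f m n.
Proof. by rewrite /tlift (tlift_eq (tensor_piK _)) big_cons big_nil addr0. Qed.

Lemma tliftD x y : tlift (x + y) = tlift x + tlift y.
Proof. by rewrite /tlift (tlift_eq (tensor_piK _)) big_cat. Qed.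

End Lift.
End Tensor.

Section TensorMaps.

Definition tmap (S : Type) (M M' N N' : zmodType)
    (ra : M -> S -> M) (la : S -> N -> N)
    (ra' : M' -> S -> M') (la' : S -> N' -> N')
    (f : M -> M') (g : N -> N') : tensor ra la -> tensor ra' la' :=
  tlift (fun m n => tens ra' la' (f m) (g n)).

Definition tlact (S T : Type) (M N : zmodType) (l : T -> M -> M)
    (ra : M -> S -> M) (la : S -> N -> N) : T -> tensor ra la -> tensor ra la :=
  fun t => tmap ra la (l t) id.

Definition tract (S T : Type) (M N : zmodType)
    (ra : M -> S -> M) (la : S -> N -> N) (r : N -> T -> N) :
    tensor ra la -> T -> tensor ra la :=
  fun x t => tmap ra la id (r^~ t) x.

(* (m (x) n) (x) p |-> m (x) (n (x) p) *)
Definition tassoc (S T : Type) (M N P : zmodType)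
    (ra : M -> S -> M) (la : S -> N -> N)
    (rb : N -> T -> N) (lb : T -> P -> P) :
    tensor (@tract _ _ _ _ ra la rb) lb ->
    tensor ra (@tlact _ _ _ _ la rb lb) :=
  tlift (fun x p => tlift (fun m n => tens ra _ m (tens rb lb n p)) x).

Definition tlunit (S : pzRingType) (N : zmodType) (la : S -> N -> N) :
    tensor ( *%R : S -> S -> S) la -> N := tlift la.

Definition trunit (S : pzRingType) (M : zmodType) (ra : M -> S -> M) :
    tensor ra ( *%R : S -> S -> S) -> M := tlift ra.

(* u = sum_i h_i (x) a_i sends m (x) n to sum_i f h_i m (x) g a_i n; see
   tact_tens and tactD for the conditions under which this makes sense. *)
Definition tact (S : Type) (H A M N : zmodType)
    (raH : H -> S -> H) (laA : S -> A -> A)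
    (raM : M -> S -> M) (laN : S -> N -> N)
    (f : H -> M -> M) (g : A -> N -> N)
    (u : tensor raH laA) : tensor raM laN -> tensor raM laN :=
  tlift (fun m n => tlift (fun h a => tens raM laN (f h m) (g a n)) u).

End TensorMaps.

Lemma tensor_ext (S : Type) (M N P : zmodType)
    (ra : M -> S -> M) (la : S -> N -> N) (f g : tensor ra la -> P) :
  {morph f : x y / x + y} -> {morph g : x y / x + y} ->
  (forall m n, f (tens ra la m n) = g (tens ra la m n)) -> f =1 g.
Proof.
move=> fD gD fg; elim/tensor_ind=> // [|x y fx fy].
  by apply: (@addIr _ (f 0)); rewrite -fD [in RHS]addrC -[in RHS](addr0 0);
     apply: (@addIr _ (g 0)); rewrite -[RHS]addrA -gD !addr0 addrC.
by rewrite fD gD fx fy.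
Qed.

Section TensorMapTheory.
Variables (S : Type) (M M' N N' : zmodType).
Variables (ra : M -> S -> M) (la : S -> N -> N).
Variables (ra' : M' -> S -> M') (la' : S -> N' -> N').
Variables (f : M -> M') (g : N -> N').
Hypotheses (fD : {morph f : x y / x + y}) (gD : {morph g : x y / x + y}).
Hypotheses (fr : forall m s, f (ra m s) = ra' (f m) s).
Hypotheses (gl : forall s n, g (la s n) = la' s (g n)).

Lemma balanced_tmap : balanced ra la (fun m n => tens ra' la' (f m) (g n)).
Proof.
split=> [m m' n|m n n'|m s n]; first by rewrite fD tensDl.
  by rewrite gD tensDr.
by rewrite fr gl tens_bal.
Qed.

Lemma tmap_tens m n :
  tmap ra' la' f g (tens ra la m n) = tens ra' la' (f m) (g n).
Proof. exact: tlift_tens balanced_tmap _ _. Qed.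

Lemma tmapD : {morph @tmap _ _ _ _ _ ra la ra' la' f g : x y / x + y}.
Proof. exact: tliftD balanced_tmap. Qed.

End TensorMapTheory.

Lemma tmap_id (S : Type) (M N : zmodType) (ra : M -> S -> M) (la : S -> N -> N) :
  @tmap _ _ _ _ _ ra la ra la id id =1 id.
Proof. by apply: tensor_ext => [||m n]; [exact: tmapD|by []|rewrite tmap_tens]. Qed.

Section TensorAct.
Variables (S : Type) (X Y M N : zmodType).
Variables (rX : X -> S -> X) (lY : S -> Y -> Y).
Variables (rM : M -> S -> M) (lN : S -> N -> N).
Variables (f : X -> M -> M) (g : Y -> N -> N).
Hypotheses (fDl : forall x x' m, f (x + x') m = f x m + f x' m)
           (fDr : forall x m m', f x (m + m') = f x m + f x m')
           (gDl : forall y y' n, g (y + y') n = g y n + g y' n)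
           (gDr : forall y n n', g y (n + n') = g y n + g y n').
Hypotheses (fr : forall x s m, f (rX x s) m = rM (f x m) s)
           (gl : forall s y n, g (lY s y) n = lN s (g y n)).

Definition tapp (m : M) (n : N) : tensor rX lY -> tensor rM lN :=
  tlift (fun x y => tens rM lN (f x m) (g y n)).

Lemma balanced_tapp m n :
  balanced rX lY (fun x y => tens rM lN (f x m) (g y n)).
Proof.
split=> [x x' y|x y y'|x s y]; first by rewrite fDl tensDl.
  by rewrite gDl tensDr.
by rewrite fr gl tens_bal.
Qed.

Lemma tapp_tens m n x y : tapp m n (tens rX lY x y) = tens rM lN (f x m) (g y n).
Proof. exact: (tlift_tens (balanced_tapp m n)). Qed.

Lemma tappD m n : {morph tapp m n : u v / u + v}.
Proof. exact: (tliftD (balanced_tapp m n)). Qed.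

(* x_t and y_s are right actions of S through which f and g are balanced; the
   hypothesis on u in tact_tens and tactD says that u lies in the corresponding
   Takeuchi product. *)
Variables (x_t : X -> S -> X) (y_s : Y -> S -> Y).
Hypotheses (x_tD : forall s, {morph x_t^~ s : x y / x + y})
           (y_sD : forall s, {morph y_s^~ s : x y / x + y})
           (x_tr : forall s x s', x_t (rX x s') s = rX (x_t x s) s')
           (y_sl : forall s x s', y_s (lY s' x) s = lY s' (y_s x s)).
Hypotheses (ft : forall x m s, f x (rM m s) = f (x_t x s) m)
           (gs : forall y n s, g y (lN s n) = g (y_s y s) n).

Lemma balanced_tact (u : tensor rX lY) :
  (forall s, tmap rX lY (x_t^~ s) id u = tmap rX lY id (y_s^~ s) u) ->
  balanced rM lN (fun m n => tapp m n u).
Proof.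
move=> tak; split=> [m m' n|m n n'|m s n].
- move: u {tak}; apply: tensor_ext => [u v|u v|x y].
  + exact: tappD.
  + by rewrite !tappD addrACA.
  + by rewrite !tapp_tens fDr tensDl.
- move: u {tak}; apply: tensor_ext => [u v|u v|x y].
  + exact: tappD.
  + by rewrite !tappD addrACA.
  + by rewrite !tapp_tens gDr tensDr.
- transitivity (tapp m n (tmap rX lY (x_t^~ s) id u)).
    move: u {tak}; apply: tensor_ext => [u v|u v|x y].
    + exact: tappD.
    + by rewrite tmapD ?tappD // => *; rewrite ?x_tr.
    + by rewrite tmap_tens ?tapp_tens ?ft // => *; rewrite ?x_tr.
  rewrite tak; move: u {tak}; apply: tensor_ext => [u v|u v|x y].
    + by rewrite tmapD ?tappD // => *; rewrite ?y_sl.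
    + exact: tappD.
    + by rewrite tmap_tens ?tapp_tens ?gs // => *; rewrite ?y_sl.
Qed.

Lemma tact_tens u m n :
  (forall s, tmap rX lY (x_t^~ s) id u = tmap rX lY id (y_s^~ s) u) ->
  tact f g u (tens rM lN m n) = tapp m n u.
Proof. by move=> tak; apply: tlift_tens (balanced_tact tak) _ _. Qed.

Lemma tactD u :
  (forall s, tmap rX lY (x_t^~ s) id u = tmap rX lY id (y_s^~ s) u) ->
  {morph @tact _ _ _ _ _ rX lY rM lN f g u : x y / x + y}.
Proof. by move=> tak; apply: tliftD (balanced_tact tak). Qed.

End TensorAct.

Arguments tlact {S T M N} l {ra la} t x.
Arguments tract {S T M N} {ra la} r x t.

(* The structures nzRingType and algType of the library exclude the zero ring,
   so a k-algebra is a ring with a ring map from k to its centre. *)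
Record kalgebra (k : comPzRingType) := KAlgebra {
  kalg_ring :> pzRingType;
  kscal : {rmorphism k -> kalg_ring};
  kscal_central : forall l x, kscal l * x = x * kscal l }.

Section OppositeAlgebra.
Variables (k : comPzRingType) (B : kalgebra k).

Definition kscal_op (l : k) : (kalg_ring B)^c := kscal B l.

Fact kscal_op_zmod : zmod_morphism kscal_op.
Proof. by move=> x y; rewrite /kscal_op raddfB. Qed.

Fact kscal_op_monoid : monoid_morphism kscal_op.
Proof.
split; first by rewrite /kscal_op rmorph1.
by move=> l l'; rewrite /kscal_op mulrC rmorphM.
Qed.

HB.instance Definition _ :=
  GRing.isZmodMorphism.Build k (kalg_ring B)^c kscal_op kscal_op_zmod.
HB.instance Definition _ :=
  GRing.isMonoidMorphism.Build k (kalg_ring B)^c kscal_op kscal_op_monoid.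

Fact kscal_op_central l (x : (kalg_ring B)^c) :
  kscal_op l * x = x * kscal_op l.
Proof. exact: (esym (kscal_central l (x : B))). Qed.

Definition kalg_op : kalgebra k := KAlgebra kscal_op_central.

End OppositeAlgebra.

Record kalg_hom (k : comPzRingType) (B B' : kalgebra k) := KAlgHom {
  kalg_fun :> {rmorphism B -> B'};
  kalg_funk : forall l, kalg_fun (kscal B l) = kscal B' l }.

Section Corings.
Variables (k : comPzRingType) (B : kalgebra k).

Record is_lmodule (M : zmodType) (l : B -> M -> M) : Prop := IsLModule {
  lmodDl : forall a b m, l (a + b) m = l a m + l b m;
  lmodDr : forall a m n, l a (m + n) = l a m + l a n;
  lmodM : forall a b m, l (a * b) m = l a (l b m);
  lmod1 : forall m, l 1 m = m }.

Record is_rmodule (M : zmodType) (r : M -> B -> M) : Prop := IsRModule {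
  rmodDl : forall m n a, r (m + n) a = r m a + r n a;
  rmodDr : forall m a b, r m (a + b) = r m a + r m b;
  rmodM : forall m a b, r m (a * b) = r (r m a) b;
  rmod1 : forall m, r m 1 = m }.

Record is_bimodule (M : zmodType) (l : B -> M -> M) (r : M -> B -> M) : Prop :=
  IsBimodule {
    bimod_l : is_lmodule l;
    bimod_r : is_rmodule r;
    bimodA : forall a m b, r (l a m) b = l a (r m b);
    bimod_k : forall (x : k) m, l (kscal B x) m = r m (kscal B x) }.

(* All maps below are additive and B-linear; with bimod_k they are k-linear. *)
Record coring_data := CoringData {
  cor_car :> zmodType;
  cor_l : B -> cor_car -> cor_car;
  cor_r : cor_car -> B -> cor_car;
  cor_delta : cor_car -> tensor cor_r cor_l;
  cor_eps : cor_car -> B }.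

Record is_coring (C : coring_data) : Prop := IsCoring {
  cor_bimod : is_bimodule (@cor_l C) (@cor_r C);
  cor_deltaD : forall x y : C, cor_delta (x + y) = cor_delta x + cor_delta y;
  cor_deltal : forall b (x : C),
    cor_delta (cor_l b x) = tlact (@cor_l C) b (cor_delta x);
  cor_deltar : forall (x : C) b,
    cor_delta (cor_r x b) = tract (@cor_r C) (cor_delta x) b;
  cor_epsD : forall x y : C, cor_eps (x + y) = cor_eps x + cor_eps y;
  cor_epsl : forall b (x : C), cor_eps (cor_l b x) = b * cor_eps x;
  cor_epsr : forall (x : C) b, cor_eps (cor_r x b) = cor_eps x * b;
  cor_coassoc : forall x : C,
    tassoc (tmap (tract (@cor_r C)) (@cor_l C) (@cor_delta C) id (cor_delta x))
    = tmap (@cor_r C) (tlact (@cor_l C)) id (@cor_delta C) (cor_delta x);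
  cor_counitl : forall x : C,
    tlunit (tmap *%R (@cor_l C) (@cor_eps C) id (cor_delta x)) = x;
  cor_counitr : forall x : C,
    trunit (tmap (@cor_r C) *%R id (@cor_eps C) (cor_delta x)) = x }.

Record is_comodule (C : coring_data) (M : zmodType) (l : B -> M -> M)
    (rho : M -> tensor (@cor_r C) l) : Prop := IsComodule {
  comod_lmod : is_lmodule l;
  comodD : forall m n, rho (m + n) = rho m + rho n;
  comodl : forall b m, rho (l b m) = tlact (@cor_l C) b (rho m);
  comod_coassoc : forall m,
    tassoc (tmap (tract (@cor_r C)) l (@cor_delta C) id (rho m))
    = tmap (@cor_r C) (tlact (@cor_l C)) id rho (rho m);
  comod_counit : forall m, tlunit (tmap *%R l (@cor_eps C) id (rho m)) = m }.

End Corings.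

Section Takeuchi.
Variables (k : comPzRingType) (R H A : kalgebra k).
Variables (tH : kalg_hom (kalg_op R) H) (sA : kalg_hom R A).

Definition src_l (r : R) (a : A) : A := sA r * a.
Definition tgt_r (h : H) (r : R) : H := tH r * h.

Definition in_takeuchi (u : tensor tgt_r src_l) : Prop := forall r : R,
  tmap tgt_r src_l (fun h => h * tH r) id u
  = tmap tgt_r src_l id (fun a => a * sA r) u.

(* rho is a k-algebra map from A into the algebra H x_R A.  The componentwise
   product u v on tensors is well defined as soon as u is in H x_R A; the
   k-algebra structure is that of the left R-action restricted to k. *)
Record takeuchi_algmap (rho : A -> tensor tgt_r src_l) : Prop := TakeuchiAlgMap {
  tak_im : forall a, in_takeuchi (rho a);
  tak_D : forall a b, rho (a + b) = rho a + rho b;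
  tak_k : forall l a, rho (kscal A l * a)
    = tmap tgt_r src_l (fun h => kscal H l * h) id (rho a);
  tak_1 : rho 1 = tens tgt_r src_l 1 1;
  tak_M : forall a b, rho (a * b) = tact *%R *%R (rho a) (rho b) }.

End Takeuchi.

Section Restriction.
Variables (k : comPzRingType) (R B : kalgebra k) (M : lmodType B).

Definition res_l (s : kalg_hom R B) (r : R) (m : M) : M := s r *: m.
Definition res_r (t : kalg_hom (kalg_op R) B) (m : M) (r : R) : M := t r *: m.

End Restriction.

Section DoiKoppinenData.
Variables (k : comPzRingType) (R : kalgebra k).

Record bialgebroid := Bialgebroid {
  bg_alg :> kalgebra k;
  bg_s : kalg_hom R bg_alg;
  bg_t : kalg_hom (kalg_op R) bg_alg;
  bg_st : forall r r' : R, bg_s r * bg_t r' = bg_t r' * bg_s r;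
  bg_delta : bg_alg -> tensor (tgt_r bg_t) (src_l bg_s);
  bg_eps : bg_alg -> R;
  bg_is_coring : is_coring (CoringData bg_delta bg_eps);
  bg_delta_alg : takeuchi_algmap bg_delta;
  bg_eps1 : bg_eps 1 = 1;
  bg_eps_s : forall g h, bg_eps (g * h) = bg_eps (g * bg_s (bg_eps h));
  bg_eps_t : forall g h, bg_eps (g * h) = bg_eps (g * bg_t (bg_eps h)) }.

Definition bg_coring (H : bialgebroid) : coring_data R :=
  CoringData (@bg_delta H) (@bg_eps H).

Variable H : bialgebroid.

Record comodule_algebra := ComoduleAlgebra {
  ca_alg :> kalgebra k;
  ca_s : kalg_hom R ca_alg;
  ca_rho : ca_alg -> tensor (tgt_r (bg_t H)) (src_l ca_s);
  ca_is_comodule : @is_comodule k R (bg_coring H) ca_alg (src_l ca_s) ca_rho;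
  ca_rho_alg : takeuchi_algmap ca_rho }.

Record module_coalgebra := ModuleCoalgebra {
  mc_mod :> lmodType H;
  mc_delta : mc_mod -> tensor (@res_r k R H mc_mod (bg_t H))
                              (@res_l k R H mc_mod (bg_s H));
  mc_eps : mc_mod -> R;
  mc_is_coring : is_coring (CoringData mc_delta mc_eps);
  mc_deltaZ : forall (h : H) c,
    mc_delta (h *: c) = tact *:%R *:%R (bg_delta h) (mc_delta c);
  mc_epsZ : forall (h : H) c,
    mc_eps (h *: c) = bg_eps (h * bg_s H (mc_eps c)) }.

Definition mc_coring (C : module_coalgebra) : coring_data R :=
  CoringData (@mc_delta C) (@mc_eps C).

End DoiKoppinenData.

Record category := Category {
  ob :> Type;
  hom : ob -> ob -> Type;
  idm : forall X, hom X X;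
  comp : forall X Y Z, hom Y Z -> hom X Y -> hom X Z;
  comp_idl : forall X Y (f : hom X Y), comp (idm Y) f = f;
  comp_idr : forall X Y (f : hom X Y), comp f (idm X) = f;
  compA : forall X Y Z T (h : hom Z T) (g : hom Y Z) (f : hom X Y),
    comp h (comp g f) = comp (comp h g) f }.

Record functor (D E : category) := Functor {
  fob :> D -> E;
  fhom : forall X Y, hom X Y -> hom (fob X) (fob Y);
  fhom_id : forall X, fhom (idm X) = idm (fob X);
  fhom_comp : forall X Y Z (g : hom Y Z) (f : hom X Y),
    fhom (comp g f) = comp (fhom g) (fhom f) }.

Definition functor_id (D : category) : functor D D :=
  @Functor D D id (fun _ _ => id) (fun _ => erefl) (fun _ _ _ _ _ => erefl).

Section FunctorComposition.
Variables (D E F : category) (G : functor E F) (K : functor D E).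

Fact functor_comp_id X : fhom G (fhom K (idm X)) = idm (G (K X)).
Proof. by rewrite !fhom_id. Qed.

Fact functor_comp_comp X Y Z (g : hom Y Z) (f : hom X Y) :
  fhom G (fhom K (comp g f)) = comp (fhom G (fhom K g)) (fhom G (fhom K f)).
Proof. by rewrite !fhom_comp. Qed.

Definition functor_comp : functor D F :=
  Functor functor_comp_id functor_comp_comp.

End FunctorComposition.

Definition isomorphic_categories (D E : category) : Prop :=
  exists (F : functor D E) (G : functor E D),
    functor_comp G F = functor_id D /\ functor_comp F G = functor_id E.

Lemma tmap_linear_comp (S : Type) (B : pzRingType) (C : zmodType)
    (M N P : lmodType B) (r : C -> S -> C) (s : S -> B) (g : N -> P) (f : M -> N)
    (lM := fun x (m : M) => s x *: m) (lN := fun x (m : N) => s x *: m)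
    (lP := fun x (m : P) => s x *: m) :
  linear g -> linear f -> forall x : tensor r lM,
  tmap r lP id g (tmap r lN id f x) = tmap r lP id (g \o f) x.
Proof.
move=> gL fL x.
have linD (U V : lmodType B) (h : U -> V) : linear h -> {morph h : u v / u + v}.
  by move=> hL u v; have := hL 1 u v; rewrite !scale1r.
have linZ (U V : lmodType B) (h : U -> V) (b : B) u :
    linear h -> h (b *: u) = b *: h u.
  move=> hL; have := hL b u 0; rewrite !addr0 => ->.
  have h0 : h 0 = 0 by have := linD _ _ _ hL 0 0; rewrite addr0 -{1}[h 0]addr0 => /addrI.
  by rewrite h0 addr0.
have gD := linD _ _ _ gL; have fD := linD _ _ _ fL.
have gZ y n : g (lN y n) = lP y (g n) by exact: linZ.
have fZ y n : f (lM y n) = lN y (f n) by exact: linZ.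
have gfD : {morph g \o f : u v / u + v} by move=> u v /=; rewrite fD gD.
have gfZ y n : (g \o f) (lM y n) = lP y ((g \o f) n) by rewrite /= fZ gZ.
move: x; apply: tensor_ext => [x y|x y|c m].
- by rewrite !tmapD.
- by rewrite !tmapD.
- by rewrite !tmap_tens.
Qed.

Section ComoduleCategory.
Variables (k : comPzRingType) (B : kalgebra k) (C : coring_data B).

Record comodule := Comodule {
  com_mod :> lmodType B;
  com_rho : com_mod -> tensor (@cor_r _ _ C) ( *:%R : B -> com_mod -> com_mod);
  com_is_comodule : is_comodule com_rho }.

Record comodule_hom (M N : comodule) := ComoduleHom {
  comh_fun :> M -> N;
  comh_linear : linear comh_fun;
  comh_colinear : forall m,
    com_rho (comh_fun m) = tmap (@cor_r _ _ C) *:%R id comh_fun (com_rho m) }.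

Lemma comodule_homP (M N : comodule) (f g : comodule_hom M N) : f =1 g -> f = g.
Proof.
case: f g => [f lf cf] [g lg cg] /= /funext fg; case: _ / fg in lg cg *.
by congr ComoduleHom; exact: Prop_irrelevance.
Qed.

Fact comodule_id_linear (M : comodule) : linear (@id M).
Proof. by []. Qed.

Fact comodule_id_colinear (M : comodule) (m : M) :
  com_rho (id m) = tmap (@cor_r _ _ C) *:%R id id (com_rho m).
Proof. by rewrite tmap_id. Qed.

Definition comodule_id (M : comodule) : comodule_hom M M :=
  ComoduleHom (@comodule_id_linear M) (@comodule_id_colinear M).

Section Composition.
Variables (M N P : comodule) (g : comodule_hom N P) (f : comodule_hom M N).

Fact comodule_comp_linear : linear (g \o f).
Proof. by move=> b m n /=; rewrite !comh_linear. Qed.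

Fact comodule_comp_colinear m :
  com_rho ((g \o f) m) = tmap (@cor_r _ _ C) *:%R id (g \o f) (com_rho m).
Proof.
by rewrite /= !comh_colinear (tmap_linear_comp (comh_linear g) (comh_linear f)).
Qed.

Definition comodule_comp : comodule_hom M P :=
  ComoduleHom comodule_comp_linear comodule_comp_colinear.

End Composition.

Definition comodule_cat : category.
Proof.
by refine (@Category comodule comodule_hom comodule_id comodule_comp _ _ _);
  move=> *; apply: comodule_homP.
Defined.

End ComoduleCategory.

Section DoiKoppinenModules.
Variables (k : comPzRingType) (R : kalgebra k) (H : bialgebroid R).
Variables (A : comodule_algebra H) (C : module_coalgebra H).

Let rC : C -> R -> C := @res_r k R H C (bg_t H).

Record dk_module := DKModule {
  dk_mod :> lmodType A;
  dk_rho : dk_mod -> tensor rC (@res_l k R A dk_mod (ca_s A));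
  dk_is_comodule :
    @is_comodule k R (mc_coring C) dk_mod (@res_l k R A dk_mod (ca_s A)) dk_rho;
  dk_rhoZ : forall (a : A) m,
    dk_rho (a *: m) = tact *:%R *:%R (ca_rho a) (dk_rho m) }.

Record dk_hom (M N : dk_module) := DKHom {
  dkh_fun :> M -> N;
  dkh_linear : linear dkh_fun;
  dkh_colinear : forall m, dk_rho (dkh_fun m)
    = tmap rC (@res_l k R A N (ca_s A)) id dkh_fun (dk_rho m) }.

Lemma dk_homP (M N : dk_module) (f g : dk_hom M N) : f =1 g -> f = g.
Proof.
case: f g => [f lf cf] [g lg cg] /= /funext fg; case: _ / fg in lg cg *.
by congr DKHom; exact: Prop_irrelevance.
Qed.

Fact dk_id_linear (M : dk_module) : linear (@id M).
Proof. by []. Qed.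

Fact dk_id_colinear (M : dk_module) (m : M) :
  dk_rho (id m) = tmap rC (@res_l k R A M (ca_s A)) id id (dk_rho m).
Proof. by rewrite tmap_id. Qed.

Definition dk_id (M : dk_module) : dk_hom M M :=
  DKHom (@dk_id_linear M) (@dk_id_colinear M).

Section Composition.
Variables (M N P : dk_module) (g : dk_hom N P) (f : dk_hom M N).

Fact dk_comp_linear : linear (g \o f).
Proof. by move=> b m n /=; rewrite !dkh_linear. Qed.

Fact dk_comp_colinear m : dk_rho ((g \o f) m)
  = tmap rC (@res_l k R A P (ca_s A)) id (g \o f) (dk_rho m).
Proof.
by rewrite /= !dkh_colinear (tmap_linear_comp (dkh_linear g) (dkh_linear f)).
Qed.

Definition dk_comp : dk_hom M P := DKHom dk_comp_linear dk_comp_colinear.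

End Composition.

Definition dk_cat : category.
Proof.
by refine (@Category dk_module dk_hom dk_id dk_comp _ _ _);
  move=> *; apply: dk_homP.
Defined.

End DoiKoppinenModules.

Section DoiKoppinenCoring.
Variables (k : comPzRingType) (R : kalgebra k) (H : bialgebroid R).
Variables (A : comodule_algebra H) (C : module_coalgebra H).

Let lC : R -> C -> C := @res_l k R H C (bg_s H).
Let rC : C -> R -> C := @res_r k R H C (bg_t H).
Let lA : R -> A -> A := src_l (ca_s A).

Definition dk_car : zmodType := tensor rC lA.
Definition dk_l (a : A) : dk_car -> dk_car := tact *:%R *%R (ca_rho a).
Definition dk_r : dk_car -> A -> dk_car := tract *%R.

(* The natural isomorphism
     (C (x)_R A) (x)_A (C (x)_R A) -> C (x)_R C (x)_R A,
   (c (x) a) (x) y |-> c (x) a . y, with the target bracketed to the left. *)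
Definition dk_merge :
    tensor dk_r dk_l -> tensor (@tract _ _ _ _ rC lC rC) lA :=
  tlift (fun x y => tlift (fun c a =>
    tlift (fun c' a' => tens _ lA (tens rC lC c c') a') (dk_l a y)) x).

(* Its inverse (c (x) c') (x) a |-> (c (x) 1) (x) (c' (x) a). *)
Definition dk_split : tensor (@tract _ _ _ _ rC lC rC) lA -> tensor dk_r dk_l :=
  tlift (fun x a =>
    tlift (fun c c' => tens dk_r dk_l (tens rC lA c 1) (tens rC lA c' a)) x).

Definition dk_delta (x : dk_car) : tensor dk_r dk_l :=
  dk_split (tmap (tract rC) lA (@mc_delta _ _ _ C) id x).

Definition dk_eps (x : dk_car) : A :=
  tlunit (tmap *%R lA (@mc_eps _ _ _ C) id x).

Definition dk_coring : coring_data A := CoringData dk_delta dk_eps.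

End DoiKoppinenCoring.

(* Main.v *)
Require Import Defs.
From mathcomp Require Import all_boot all_order all_algebra.
From mathcomp Require Import boolp.

(* For a left A-module M, contracting the inner A gives an isomorphism
     (C (x)_R A) (x)_A M -> C (x)_R M,  (c (x) a) (x) m |-> c (x) a m,
   under which the left A-action of the source becomes
   a (c (x) m) = a_<-1> c (x) a_<0> m.  Composing coactions with it therefore
   turns a left (C (x)_R A)-comodule structure on M into a Doi-Koppinen module
   structure and back.  The coring axioms of C (x)_R A are for the most part an
   instance of this: C (x)_R A is itself a Doi-Koppinen module with coaction
   Delta_C (x) A, and Delta_C (x) A expanded back is the comultiplication, so
   its left linearity, coassociativity and left counit law are the comodule
   axioms of the expanded coaction. *)

Set Implicit Arguments.
Unset Strict Implicit.
Unset Printing Implicit Defensive.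

Import GRing.Theory.
Local Open Scope ring_scope.

(** * Tensor products over noncommutative rings *)

Section TensorActions.
Variables (S T : Type) (M N : zmodType) (ra : M -> S -> M) (la : S -> N -> N).

Section Left.
Variable l : T -> M -> M.
Hypotheses (lD : forall t, {morph l t : x y / x + y})
           (lr : forall t m s, l t (ra m s) = ra (l t m) s).

Lemma tlact_tens t m n : tlact l t (tens ra la m n) = tens ra la (l t m) n.
Proof. by rewrite /tlact tmap_tens. Qed.

Lemma tlactD t : {morph tlact l t : x y / x + y :> tensor ra la}.
Proof. exact: tmapD. Qed.
End Left.

Section Right.
Variable r : N -> T -> N.
Hypotheses (rD : forall t, {morph r^~ t : x y / x + y})
           (rl : forall t s n, r (la s n) t = la s (r n t)).

Lemma tract_tens t m n : tract r (tens ra la m n) t = tens ra la m (r n t).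
Proof. by rewrite /tract tmap_tens. Qed.

Lemma tractD t : {morph (@tract _ _ _ _ ra la r)^~ t : x y / x + y}.
Proof. exact: tmapD. Qed.
End Right.
End TensorActions.

Section TensorAssociativity.
Variables (S T : Type) (M N P : zmodType).
Variables (ra : M -> S -> M) (la : S -> N -> N).
Variables (rb : N -> T -> N) (lb : T -> P -> P).
Hypotheses (laD : forall s, {morph la s : x y / x + y})
           (rbD : forall t, {morph rb^~ t : x y / x + y})
           (larb : forall s n t, la s (rb n t) = rb (la s n) t).

Let inner (p : P) : tensor ra la -> tensor ra (@tlact _ _ _ _ la rb lb) :=
  tlift (fun m n => tens ra _ m (tens rb lb n p)).

Let inner_balanced p :
  balanced ra la
    (fun m n => tens ra (@tlact _ _ _ _ la rb lb) m (tens rb lb n p)).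
Proof.
split=> *; first by rewrite tensDl.
  by rewrite tensDl tensDr.
by rewrite tens_bal tlact_tens.
Qed.

Let assoc_balanced : balanced (@tract _ _ _ _ ra la rb) lb (fun x p => inner p x).
Proof.
have rl t s n : rb (la s n) t = la s (rb n t) by rewrite larb.
have iD p : {morph inner p : x y / x + y} by exact: tliftD (inner_balanced p).
have it p m n : inner p (tens _ _ m n) = tens ra _ m (tens rb lb n p).
  exact: tlift_tens (inner_balanced p) _ _.
split=> [m m' n|x p p'|x t p]; first exact: iD.
- move: x; apply: tensor_ext => [x y|x y|m n]; rewrite ?iD ?it ?tensDr //.
  by rewrite addrACA.
- move: x; apply: tensor_ext => [x y|x y|m n]; rewrite ?(tractD rbD rl) ?iD //.
  by rewrite tract_tens // !it tens_bal.
Qed.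

Lemma tassoc_tens m n p :
  tassoc (tens (@tract _ _ _ _ ra la rb) lb (tens ra la m n) p)
  = tens ra _ m (tens rb lb n p).
Proof.
rewrite /tassoc (tlift_tens assoc_balanced).
exact: tlift_tens (inner_balanced p) _ _.
Qed.

Lemma tassocD : {morph @tassoc _ _ _ _ _ ra la rb lb : x y / x + y}.
Proof. exact: tliftD assoc_balanced. Qed.
End TensorAssociativity.

Lemma tlunit_tens (S : pzRingType) (N : zmodType) (la : S -> N -> N) :
  balanced *%R la la -> forall s n, tlunit (tens *%R la s n) = la s n.
Proof. by move=> b s n; exact: tlift_tens. Qed.

Lemma tlunitD (S : pzRingType) (N : zmodType) (la : S -> N -> N) :
  balanced *%R la la -> {morph @tlunit S N la : x y / x + y}.
Proof. by move=> b; exact: tliftD. Qed.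

Lemma trunit_tens (S : pzRingType) (M : zmodType) (ra : M -> S -> M) :
  balanced ra *%R ra -> forall m s, trunit (tens ra *%R m s) = ra m s.
Proof. by move=> b m s; exact: tlift_tens. Qed.

Lemma trunitD (S : pzRingType) (M : zmodType) (ra : M -> S -> M) :
  balanced ra *%R ra -> {morph @trunit S M ra : x y / x + y}.
Proof. by move=> b; exact: tliftD. Qed.

(** An additive map sends 0 to 0, hence is determined by a representative. An identity in two
    tensors can thus be split into the terms of one of them before induction on the other. *)
Lemma tensor_morph_sum (S : Type) (M N P : zmodType)
    (ra : M -> S -> M) (la : S -> N -> N) (f : tensor ra la -> P) x :
  {morph f : x y / x + y} ->
  f x = \sum_(p <- tensor_repr x) f (tens ra la p.1 p.2).
Proof.
move=> fD; have f0 : f 0 = 0 by apply: (@addIr _ (f 0)); rewrite -fD !add0r.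
by rewrite [in LHS](tens_sum x) (big_morph f fD f0).
Qed.

Lemma mul_lmodule (k : comPzRingType) (B : kalgebra k) :
  is_lmodule ( *%R : B -> B -> B).
Proof. by split=> *; rewrite ?mulrDl ?mulrDr ?mulrA ?mul1r. Qed.

Lemma scale_lmodule (k : comPzRingType) (B : kalgebra k) (M : lmodType B) :
  is_lmodule ( *:%R : B -> M -> M).
Proof. by split=> *; rewrite ?scalerDl ?scalerDr ?scalerA ?scale1r. Qed.

(** * Action of a Takeuchi product on a tensor product of modules *)

Section TakeuchiAction.
Variables (k : comPzRingType) (R H A : kalgebra k).
Variables (tH : kalg_hom (kalg_op R) H) (sA : kalg_hom R A).
Variables (X Y : zmodType) (lX : H -> X -> X) (lY : A -> Y -> Y).
Variables (rX : X -> R -> X) (lYR : R -> Y -> Y).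
Hypotheses (modX : is_lmodule lX) (modY : is_lmodule lY).
Hypotheses (rXE : forall x r, rX x r = lX (tH r) x).
Hypotheses (lYRE : forall r y, lYR r y = lY (sA r) y).

(** The sum of the h x (x) a y over u = sum h (x) a, with x and y fixed. It is additive on all of H
    (x)_R A, so induction on u is possible, whereas [tact] at u respects the balancing of X (x)_R Y
    when u lies in the Takeuchi product. *)
Definition tak_eval (x : X) (y : Y) :
    tensor (tgt_r tH) (src_l sA) -> tensor rX lYR :=
  tapp rX lYR lX lY x y.

Lemma tak_eval_tens x y h a :
  tak_eval x y (tens _ _ h a) = tens rX lYR (lX h x) (lY a y).
Proof.
apply: tapp_tens => *; rewrite ?(lmodDl modX) ?(lmodDl modY) //.
  by rewrite rXE -(lmodM modX).
by rewrite lYRE -(lmodM modY).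
Qed.

Lemma tak_evalD x y : {morph tak_eval x y : u v / u + v}.
Proof.
apply: tappD => *; rewrite ?(lmodDl modX) ?(lmodDl modY) //.
  by rewrite rXE -(lmodM modX).
by rewrite lYRE -(lmodM modY).
Qed.

Lemma tak_act_tens (u : tensor (tgt_r tH) (src_l sA)) x y : in_takeuchi u ->
  tact lX lY u (tens rX lYR x y) = tak_eval x y u.
Proof.
(* The Takeuchi condition is expressed by right multiplication with t_H(r) on H and s_A(r) on A;
   acting on r-translates of x and y amounts to these multiplications. *)
apply: (@tact_tens _ _ _ _ _ _ _ _ _ _ _ _ _ _ _ _ _
          (fun h r => h * tH r) (fun a r => a * sA r)).
all: try by move=> *; rewrite ?(lmodDl modX) ?(lmodDl modY) ?(lmodDr modX)
                              ?(lmodDr modY).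
all: try by move=> s p q; exact: mulrDl.
all: try by move=> *; rewrite ?rXE ?lYRE -?(lmodM modX) -?(lmodM modY).
all: try by move=> *; rewrite /src_l /tgt_r mulrA.
Qed.

Lemma tak_actD (u : tensor (tgt_r tH) (src_l sA)) : in_takeuchi u ->
  {morph @tact _ _ _ _ _ _ _ rX lYR lX lY u : x y / x + y}.
Proof.
apply: (@tactD _ _ _ _ _ _ _ _ _ _ _ _ _ _ _ _ _
          (fun h r => h * tH r) (fun a r => a * sA r)).
all: try by move=> *; rewrite ?(lmodDl modX) ?(lmodDl modY) ?(lmodDr modX)
                              ?(lmodDr modY).
all: try by move=> s p q; exact: mulrDl.
all: try by move=> *; rewrite ?rXE ?lYRE -?(lmodM modX) -?(lmodM modY).
all: try by move=> *; rewrite /src_l /tgt_r mulrA.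
Qed.

End TakeuchiAction.

Section TakeuchiProduct.
Variables (k : comPzRingType) (R H A : kalgebra k).
Variables (tH : kalg_hom (kalg_op R) H) (sA : kalg_hom R A).
Variables (X Y : zmodType) (lX : H -> X -> X) (lY : A -> Y -> Y).
Variables (rX : X -> R -> X) (lYR : R -> Y -> Y).
Hypotheses (modX : is_lmodule lX) (modY : is_lmodule lY).
Hypotheses (rXE : forall x r, rX x r = lX (tH r) x).
Hypotheses (lYRE : forall r y, lYR r y = lY (sA r) y).
Let T := tensor (tgt_r tH) (src_l sA).

(** The inner evaluation, on the regular modules, is the product u (h (x) a), so this is
    associativity of the two actions. *)
Lemma tak_eval_comp x y h a (u : T) :
  tak_eval lX lY rX lYR (lX h x) (lY a y) u
  = tak_eval lX lY rX lYR x y (tak_eval *%R *%R (tgt_r tH) (src_l sA) h a u : T).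
Proof.
have [mH mA] := (mul_lmodule H, mul_lmodule A).
have D := tak_evalD modX modY rXE lYRE.
have E := tak_eval_tens modX modY rXE lYRE.
have TD : {morph (tak_eval *%R *%R (tgt_r tH) (src_l sA) h a : T -> T) :
    u v / u + v}.
  exact: tak_evalD.
move: u; apply: tensor_ext => [u v|u v|h' a']; first exact: D.
  by rewrite TD D.
by rewrite E tak_eval_tens // E (lmodM modX) (lmodM modY).
Qed.

(** The componentwise product acts as the composite of the actions. For v = h (x) a the product u v
    is u evaluated at (h, a), which reduces the claim to [tak_eval_comp]. *)
Lemma tak_eval_tact x y (u v : T) : in_takeuchi u ->
  tak_eval lX lY rX lYR x y (tact *%R *%R u v : T)
  = tact lX lY u (tak_eval lX lY rX lYR x y v).
Proof.
have [mH mA] := (mul_lmodule H, mul_lmodule A).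
have D := tak_evalD modX modY rXE lYRE.
have E := tak_eval_tens modX modY rXE lYRE.
move=> tu; have TD : {morph (tact *%R *%R u : T -> T) : u v / u + v}.
  exact: tak_actD.
have UD := tak_actD modX modY rXE lYRE tu.
move: v; apply: tensor_ext => [v w|v w|h a]; first by rewrite TD D.
  by rewrite D UD.
by rewrite E !tak_act_tens // tak_eval_comp.
Qed.

End TakeuchiProduct.

(** * The coring C (x)_R A and its comodules *)

Section DoiKoppinen.
Variables (k : comPzRingType) (R : kalgebra k) (H : bialgebroid R).
Variables (A : comodule_algebra H) (C : module_coalgebra H).

Let lC : R -> C -> C := @res_l k R H C (bg_s H).
Let rC : C -> R -> C := @res_r k R H C (bg_t H).
Let lH : R -> H -> H := src_l (bg_s H).
Let rH : H -> R -> H := tgt_r (bg_t H).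
Let lA : R -> A -> A := src_l (ca_s A).
Let sA := ca_s A.
Let dkl := @dk_l k R H A C.
Let dkr := @dk_r k R H A C.

Let modA : is_lmodule ( *%R : A -> A -> A). Proof. exact: mul_lmodule. Qed.
Let modH : is_lmodule ( *%R : H -> H -> H). Proof. exact: mul_lmodule. Qed.
Let modC : is_lmodule ( *:%R : H -> C -> C). Proof. exact: scale_lmodule. Qed.
Let rCE c r : rC c r = bg_t H r *: c. Proof. by []. Qed.
Let lCE r c : lC r c = bg_s H r *: c. Proof. by []. Qed.
Let rHE h r : rH h r = bg_t H r * h. Proof. by []. Qed.
Let lAE r a : lA r a = sA r * a. Proof. by []. Qed.

Let lAD r : {morph lA r : x y / x + y}.
Proof. by move=> x y; exact: mulrDr. Qed.

Let lCD r : {morph lC r : x y / x + y}.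
Proof. by move=> x y; exact: scalerDr. Qed.

Let rCD r : {morph rC^~ r : x y / x + y}.
Proof. by move=> x y; exact: scalerDr. Qed.

Let lCrC r c r' : lC r (rC c r') = rC (lC r c) r'.
Proof. by rewrite /lC /rC /res_l /res_r !scalerA bg_st. Qed.

Let lHD r : {morph lH r : x y / x + y}.
Proof. by move=> x y; exact: mulrDr. Qed.

Let rHD r : {morph rH^~ r : x y / x + y}.
Proof. by move=> x y; exact: mulrDr. Qed.

Let lHrH r h r' : lH r (rH h r') = rH (lH r h) r'.
Proof. by rewrite /lH /rH /src_l /tgt_r !mulrA bg_st. Qed.

(** The coaction is left R-linear and sends 1 to 1 (x) 1. Consequently the A-action on C (x)_R M
    restricts along s_A to the R-action on C. *)
Lemma ca_rho_src r : ca_rho (sA r) = tens rH lA (bg_s H r) 1.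
Proof.
have := comodl (ca_is_comodule A) r 1.
rewrite /src_l mulr1 => ->; rewrite (tak_1 (ca_rho_alg A)) /=.
by rewrite tlact_tens // /lH /src_l mulr1.
Qed.

(* The restricted action lR is a separate argument because on C (x)_R M it is
   tlact lC, which agrees with the restriction of dk_act only propositionally. *)
Section Module.
Variables (M : zmodType) (l : A -> M -> M) (lR : R -> M -> M).
Hypotheses (lM : is_lmodule l) (lRE : forall r m, lR r m = l (sA r) m).

(** Stated for an arbitrary A-module M: M = A gives [dk_l], and M = C (x)_R A gives the action on C
    (x)_R C (x)_R A. *)
Definition dk_act (a : A) : tensor rC lR -> tensor rC lR :=
  tact *:%R l (ca_rho a).

Let ev (c : C) (m : M) : tensor rH lA -> tensor rC lR :=
  tak_eval *:%R l rC lR c m.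

Let tak a := tak_im (ca_rho_alg A) a.

Let evE c m h a : ev c m (tens _ _ h a) = tens rC lR (h *: c) (l a m).
Proof. exact: tak_eval_tens. Qed.

Let evD c m : {morph ev c m : x y / x + y}.
Proof. exact: tak_evalD. Qed.

Lemma dk_act_tens a c m : dk_act a (tens rC lR c m) = ev c m (ca_rho a).
Proof. exact: tak_act_tens (tak a). Qed.

Lemma dk_actD a : {morph dk_act a : x y / x + y}.
Proof. exact: tak_actD (tak a). Qed.

Lemma dk_act_src r x : dk_act (sA r) x = tlact lC r x.
Proof.
move: x; apply: tensor_ext => [x y|x y|c m]; first exact: dk_actD.
  exact: tlactD.
rewrite dk_act_tens ca_rho_src evE (lmod1 lM).
by rewrite tlact_tens.
Qed.

(** The module axioms mirror the coaction being an algebra map into the Takeuchi product;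
    associativity is multiplicativity of the coaction combined with [tak_eval_tact]. *)
Lemma dk_lmodule : is_lmodule dk_act.
Proof.
split.
- move=> a b; apply: tensor_ext => [x y|x y|c m]; first exact: dk_actD.
    by rewrite !dk_actD addrACA.
  by rewrite !dk_act_tens (tak_D (ca_rho_alg A)) evD.
- by move=> a x y; exact: dk_actD.
- move=> a b; apply: tensor_ext => [x y|x y|c m]; first exact: dk_actD.
    by rewrite !dk_actD.
  by rewrite !dk_act_tens (tak_M (ca_rho_alg A)) /ev tak_eval_tact.
- apply: tensor_ext => [x y|x y|c m] //; first exact: dk_actD.
  by rewrite dk_act_tens (tak_1 (ca_rho_alg A)) evE (lmod1 lM) scale1r.
Qed.

Definition dk_contract : tensor dkr l -> tensor rC lR :=
  tlift (fun x m => tmap rC lR id (l^~ m) x).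

Definition dk_expand : tensor rC lR -> tensor dkr l :=
  tlift (fun c m => tens dkr l (tens rC lA c 1) m).

Let lDl m : {morph l^~ m : x y / x + y}.
Proof. by move=> x y; exact: (lmodDl lM). Qed.

Let lAl r a m : l (lA r a) m = lR r (l a m).
Proof. by rewrite lRE -(lmodM lM). Qed.

Let mulD (b : A) : {morph *%R^~ b : x y / x + y}.
Proof. by move=> x y; exact: mulrDl. Qed.

Let lA_mul r a b : lA r a * b = lA r (a * b).
Proof. by rewrite /lA /src_l mulrA. Qed.

Lemma dk_r_tens c a b : dkr (tens rC lA c a) b = tens rC lA c (a * b).
Proof. exact: tract_tens. Qed.

Lemma dk_rD b : {morph dkr^~ b : x y / x + y}.
Proof. exact: tractD. Qed.

Let contract_balanced :
  balanced dkr l (fun x m => tmap rC lR id (l^~ m) x).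
Proof.
have tD m : {morph (tmap rC lR id (l^~ m) : tensor rC lA -> _) : x y / x + y}.
  exact: tmapD.
have tE m c a : tmap rC lR id (l^~ m) (tens rC lA c a) = tens rC lR c (l a m).
  by rewrite tmap_tens.
split=> [x y m|x m n|x a m]; first exact: tD.
- move: x; apply: tensor_ext => [x y|x y|c b]; rewrite ?tD ?tE //.
    by rewrite addrACA.
  by rewrite (lmodDr lM) tensDr.
- move: x; apply: tensor_ext => [x y|x y|c b]; rewrite ?dk_rD ?tD //.
  by rewrite dk_r_tens !tE (lmodM lM).
Qed.

Let expand_balanced :
  balanced rC lR (fun c m => tens dkr l (tens rC lA c 1) m).
Proof.
split=> [c c' m|c m n|c r m]; rewrite ?tensDl ?tensDr //.
by rewrite lRE -[RHS]tens_bal dk_r_tens [in LHS]tens_bal /lA /src_l mulr1 mul1r.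
Qed.

Lemma dk_contract_tens c a m :
  dk_contract (tens dkr l (tens rC lA c a) m) = tens rC lR c (l a m).
Proof. by rewrite /dk_contract tlift_tens // tmap_tens. Qed.

Lemma dk_contractD : {morph dk_contract : x y / x + y}.
Proof. exact: tliftD. Qed.

Lemma dk_expand_tens c m :
  dk_expand (tens rC lR c m) = tens dkr l (tens rC lA c 1) m.
Proof. exact: tlift_tens. Qed.

Lemma dk_expandD : {morph dk_expand : x y / x + y}.
Proof. exact: tliftD. Qed.

Lemma dk_expandK : cancel dk_expand dk_contract.
Proof.
apply: tensor_ext => [x y|//|c m]; first by rewrite dk_expandD dk_contractD.
by rewrite dk_expand_tens dk_contract_tens (lmod1 lM).
Qed.

Lemma dk_tensor_ext (P : zmodType) (f g : tensor dkr l -> P) :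
  {morph f : x y / x + y} -> {morph g : x y / x + y} ->
  (forall c a m, f (tens dkr l (tens rC lA c a) m)
                 = g (tens dkr l (tens rC lA c a) m)) -> f =1 g.
Proof.
move=> fD gD fg; apply: tensor_ext => // x m; move: x.
by apply: tensor_ext => [x y|x y|c a]; rewrite ?tensDl ?fD ?gD.
Qed.

Lemma dk_contractK : cancel dk_contract dk_expand.
Proof.
apply: dk_tensor_ext => [x y|//|c a m]; first by rewrite dk_contractD dk_expandD.
(* The round trip gives (c (x) 1) (x) a m; moving a across the tensor product over A gives back (c
   (x) a) (x) m. *)
by rewrite dk_contract_tens dk_expand_tens -tens_bal dk_r_tens mul1r.
Qed.

End Module.

(** * The A-bimodule C (x)_R A *)

Lemma dk_l_lmodule : is_lmodule dkl.
Proof. exact: dk_lmodule. Qed.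

Lemma dk_l_src r x : dkl (sA r) x = tlact lC r x.
Proof. exact: dk_act_src. Qed.

Let lC_src r x : tlact lC r x = dkl (sA r) x.
Proof. by rewrite dk_l_src. Qed.

(** Naturality of C (x)_R M in the A-module M. Applied to right multiplication by an element of A,
    it makes the left and right actions on C (x)_R A commute. *)
Lemma dk_act_tmap (M N : zmodType) (l : A -> M -> M) (l' : A -> N -> N)
    (lR : R -> M -> M) (lR' : R -> N -> N) (f : M -> N) a x :
  is_lmodule l -> is_lmodule l' ->
  (forall r m, lR r m = l (sA r) m) -> (forall r m, lR' r m = l' (sA r) m) ->
  {morph f : x y / x + y} -> (forall b m, f (l b m) = l' b (f m)) ->
  tmap rC lR' id f (@dk_act M l lR a x) = @dk_act N l' lR' a (tmap rC lR' id f x).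
Proof.
move=> lM lN lRE lRE' fD fl.
have flR r m : f (lR r m) = lR' r (f m) by rewrite lRE fl lRE'.
have fE c m : tmap rC lR' id f (tens rC lR c m) = tens rC lR' c (f m).
  by rewrite tmap_tens.
have tD : {morph (tmap rC lR' id f : tensor rC lR -> _) : x y / x + y}.
  exact: tmapD.
have aD := dk_actD lM lRE; have aD' := dk_actD lN lRE'.
move: x; apply: tensor_ext => [x y|x y|c m]; rewrite ?tD ?aD ?aD' ?tD //.
rewrite fE !dk_act_tens //.
have eD := tak_evalD modC lM rCE lRE; have eD' := tak_evalD modC lN rCE lRE'.
move: (ca_rho a); apply: tensor_ext => [x y|x y|h b]; rewrite ?eD ?eD' ?tD //.
by rewrite !tak_eval_tens // fE fl.
Qed.

Lemma dk_lr a x b : dkr (dkl a x) b = dkl a (dkr x b).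
Proof.
apply: (dk_act_tmap (f := fun y : A => y * b)) => // [y z|*].
  exact: mulrDl.
by rewrite mulrA.
Qed.

Lemma dk_bimodule : is_bimodule dkl dkr.
Proof.
split; [exact: dk_l_lmodule| |exact: dk_lr|].
- split=> [m n a|m a b|m a b|m]; first exact: dk_rD.
  + move: m; apply: tensor_ext => [x y|x y|c a']; rewrite ?dk_rD //.
      by rewrite addrACA.
    by rewrite !dk_r_tens mulrDr tensDr.
  + move: m; apply: tensor_ext => [x y|x y|c a']; rewrite ?dk_rD //.
    by rewrite !dk_r_tens mulrA.
  + move: m; apply: tensor_ext => [x y|x y|c a']; rewrite ?dk_rD //.
    by rewrite !dk_r_tens mulr1.
- move=> x m; rewrite -(kalg_funk sA) dk_l_src.
  have tE c a : tlact lC (kscal R x) (tens rC lA c a)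
              = tens rC lA (lC (kscal R x) c) a.
    by rewrite tlact_tens.
  move: m; apply: tensor_ext => [y z|y z|c a]; last 1 first.
  (* A scalar of k acting on the right is central in A, so it can be moved to the left of a and then
     over R onto c, where it acts through t_H; s_H and t_H agree on k. *)
  + rewrite tE dk_r_tens (kalg_funk sA) -kscal_central -(kalg_funk sA).
    rewrite -[sA _ * a]/(lA _ a) -tens_bal; congr tens.
    rewrite /lC /rC /res_l /res_r (kalg_funk (bg_s H)).
    by rewrite (kalg_funk (bg_t H)).
  + exact: tlactD.
  + by rewrite dk_rD.
Qed.

(** * Comultiplication and counit on pure tensors, and their right linearity *)

Let dC : C -> tensor rC lC := @mc_delta k R H C.
Let eC : C -> R := @mc_eps k R H C.
Let dklM := dk_l_lmodule.

Let dCD : {morph dC : x y / x + y}.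
Proof. by move=> x y; exact: (cor_deltaD (mc_is_coring C)). Qed.

Let dCr c r : dC (rC c r) = tract rC (dC c) r.
Proof. exact: (cor_deltar (mc_is_coring C)). Qed.

Let dCl r c : dC (lC r c) = tlact lC r (dC c).
Proof. exact: (cor_deltal (mc_is_coring C)). Qed.

Let rClC r s c : rC (lC s c) r = lC s (rC c r).
Proof. by rewrite lCrC. Qed.

Let dklD a : {morph dkl a : x y / x + y}.
Proof. by move=> x y; rewrite (lmodDr dklM). Qed.

Let tlact_lC_tens (N : zmodType) (lN : R -> N -> N) r c n :
  tlact lC r (tens rC lN c n) = tens rC lN (lC r c) n.
Proof. exact: tlact_tens. Qed.

Let tract_rC_tens r c c' :
  tract rC (tens rC lC c c') r = tens rC lC c (rC c' r).
Proof. exact: tract_tens. Qed.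

Let tract_rC_D r : {morph (@tract _ _ _ _ rC lC rC)^~ r : x y / x + y}.
Proof. exact: tractD. Qed.

Let split1 (a : A) : tensor rC lC -> tensor dkr dkl :=
  tlift (fun c c' => tens dkr dkl (tens rC lA c 1) (tens rC lA c' a)).

Let split1_balanced a : balanced rC lC
  (fun c c' => tens dkr dkl (tens rC lA c 1) (tens rC lA c' a)).
Proof.
split=> [c c' d|c d d'|c r d]; rewrite ?tensDl ?tensDr //.
(* The element r acting on d acts on d (x) a as s_A(r), so it can cross the tensor product over A;
   then c (x) s_A(r) = c r (x) 1. *)
rewrite -tlact_lC_tens -dk_l_src -tens_bal dk_r_tens; congr tens.
by rewrite mul1r tens_bal /lA /src_l mulr1.
Qed.

Let split1E a c c' : split1 a (tens rC lC c c')
  = tens dkr dkl (tens rC lA c 1) (tens rC lA c' a).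
Proof. exact: tlift_tens (split1_balanced a) _ _. Qed.

Let split1D a : {morph split1 a : x y / x + y}.
Proof. exact: tliftD (split1_balanced a). Qed.

Let split_balanced :
  balanced (@tract _ _ _ _ rC lC rC) lA (fun x a => split1 a x).
Proof.
split=> [x y a|x a b|x r a]; first exact: split1D.
- move: x; apply: tensor_ext => [x y|x y|c c']; rewrite ?split1D //.
    by rewrite addrACA.
  by rewrite !split1E !tensDr.
- move: x; apply: tensor_ext => [x y|x y|c c']; rewrite ?tract_rC_D ?split1D //.
  by rewrite tract_rC_tens !split1E tens_bal.
Qed.

Lemma dk_split_tens c c' a :
  @dk_split k R H A C (tens (@tract _ _ _ _ rC lC rC) lA (tens rC lC c c') a)
  = tens dkr dkl (tens rC lA c 1) (tens rC lA c' a).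
Proof. by rewrite -split1E; exact: (tlift_tens split_balanced). Qed.

Lemma dk_splitD : {morph @dk_split k R H A C : x y / x + y}.
Proof. exact: tliftD split_balanced. Qed.

Lemma dk_delta_tens c a : @dk_delta k R H A C (tens rC lA c a)
  = dk_split (tens (@tract _ _ _ _ rC lC rC) lA (dC c) a).
Proof. by rewrite /dk_delta tmap_tens. Qed.

Lemma dk_deltaD : {morph @dk_delta k R H A C : x y / x + y}.
Proof. by move=> x y; rewrite /dk_delta tmapD ?dk_splitD. Qed.

Let dkrl t s n : dkr (dkl s n) t = dkl s (dkr n t).
Proof. exact: dk_lr. Qed.

Lemma dk_delta_r x b : @dk_delta k R H A C (dkr x b) = tract dkr (dk_delta x) b.
Proof.
have rD t : {morph (@tract _ _ _ _ dkr dkl dkr)^~ t : x y / x + y}.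
  by apply: tractD; [exact: dk_rD|move=> *; exact: dkrl].
move: x; apply: tensor_ext => [x y|x y|c a];
  rewrite ?dk_rD ?dk_deltaD ?rD // dk_r_tens !dk_delta_tens.
move: (dC c); apply: tensor_ext => [x y|x y|c1 c2];
  rewrite ?tensDl ?dk_splitD ?rD //.
rewrite !dk_split_tens tract_tens ?dk_r_tens //; exact: dk_rD.
Qed.

Let epsM (N : zmodType) (lN : R -> N -> N) c (n : N) : is_lmodule lN ->
  tlunit (tmap *%R lN eC id (tens rC lN c n)) = lN (eC c) n.
Proof.
move=> lNM; rewrite tmap_tens ?tlunit_tens //.
- by split=> *; rewrite ?(lmodDl lNM) ?(lmodDr lNM) ?(lmodM lNM).
- by move=> x y; exact: (cor_epsD (mc_is_coring C)).
- by move=> *; exact: (cor_epsr (mc_is_coring C)).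
Qed.

Let epsMD (N : zmodType) (lN : R -> N -> N) : is_lmodule lN ->
  {morph (fun x : tensor rC lN => tlunit (tmap *%R lN eC id x)) : x y / x + y}.
Proof.
move=> lNM x y /=; rewrite tmapD //.
- apply: tlunitD.
  by split=> *; rewrite ?(lmodDl lNM) ?(lmodDr lNM) ?(lmodM lNM).
- by move=> u v; exact: (cor_epsD (mc_is_coring C)).
- by move=> *; exact: (cor_epsr (mc_is_coring C)).
Qed.

Lemma restrict_lmodule (M : zmodType) (l : A -> M -> M) (lR : R -> M -> M) :
  is_lmodule l -> (forall r m, lR r m = l (sA r) m) -> is_lmodule lR.
Proof.
move=> lM lRE; split=> *; rewrite !lRE ?rmorphD ?rmorphM ?rmorph1.
- exact: (lmodDl lM).
- exact: (lmodDr lM).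
- exact: (lmodM lM).
- exact: (lmod1 lM).
Qed.

Let lAM : is_lmodule lA.
Proof. exact: (restrict_lmodule modA). Qed.

Lemma dk_eps_tens c a : @dk_eps k R H A C (tens rC lA c a) = sA (eC c) * a.
Proof. exact: epsM. Qed.

Lemma dk_epsD : {morph @dk_eps k R H A C : x y / x + y}.
Proof. exact: epsMD. Qed.

Lemma dk_eps_r x a : @dk_eps k R H A C (dkr x a) = dk_eps x * a.
Proof.
move: x; apply: tensor_ext => [x y|x y|c b].
- by rewrite dk_rD dk_epsD.
- by rewrite dk_epsD mulrDl.
- by rewrite dk_r_tens !dk_eps_tens mulrA.
Qed.

(** * Transfer of comodule structures along the contraction *)

Section Comodules.
Variables (M : zmodType) (l : A -> M -> M) (lR : R -> M -> M).
Hypotheses (lM : is_lmodule l) (lRE : forall r m, lR r m = l (sA r) m).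

Let act := @dk_act M l lR.
Let actM : is_lmodule act. Proof. exact: dk_lmodule. Qed.
Let actRE r x : tlact lC r x = act (sA r) x. Proof. by rewrite /act dk_act_src. Qed.
Let contract := @dk_contract M l lR.
Let expand := @dk_expand M l lR.
Let lRM : is_lmodule lR. Proof. exact: (restrict_lmodule lM lRE). Qed.

Let tlact_dkl_tens a x m : tlact dkl a (tens dkr l x m) = tens dkr l (dkl a x) m.
Proof. by apply: tlact_tens; [exact: dklD|move=> *; rewrite dkrl]. Qed.

Let tlact_dklD a : {morph (tlact dkl a : tensor dkr l -> _) : x y / x + y}.
Proof. by apply: tlactD; [exact: dklD|move=> *; rewrite dkrl]. Qed.

Let contractD : {morph contract : x y / x + y}. Proof. exact: dk_contractD. Qed.
Let expandD : {morph expand : x y / x + y}. Proof. exact: dk_expandD. Qed.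
Let actD a : {morph act a : x y / x + y}. Proof. exact: dk_actD. Qed.
Let contractE c a m :
  contract (tens dkr l (tens rC lA c a) m) = tens rC lR c (l a m).
Proof. exact: dk_contract_tens. Qed.

(** Both sides are additive in the coaction of a, and on a term h (x) d of it they agree because (d
    b) m = d (b m). *)
Lemma dk_contract_l a z : contract (tlact dkl a z) = act a (contract z).
Proof.
move: z; apply: dk_tensor_ext => [x y|x y|c b m].
- by rewrite tlact_dklD contractD.
- by rewrite contractD actD.
rewrite tlact_dkl_tens contractE /act dk_act_tens //.
rewrite /dkl -[dk_l a]/(@dk_act A *%R lA a) dk_act_tens //.
have eD := tak_evalD modC lM rCE lRE; have eD' := tak_evalD modC modA rCE lAE.
move: (ca_rho a); apply: tensor_ext => [x y|x y|h d].
- by rewrite eD' tensDl contractD.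
- exact: eD.
- by rewrite !tak_eval_tens // contractE (lmodM lM).
Qed.

Lemma dk_expand_l a z : expand (act a z) = tlact dkl a (expand z).
Proof.
apply: (can_inj (dk_contractK lM lRE)); rewrite -/contract dk_contract_l.
by rewrite /expand /contract !dk_expandK.
Qed.

(* (C (x)_R A) (x)_A (C (x)_R A) (x)_A M -> C (x)_R C (x)_R M *)
Let contract2 (z : tensor dkr (tlact dkl)) : tensor rC (tlact lC) :=
  @dk_contract _ act (tlact lC) (tmap dkr act id contract z).

Let tmap_contractD : {morph (tmap dkr act id contract :
    tensor dkr (tlact dkl) -> _) : x y / x + y}.
Proof. by apply: tmapD => // *; exact: dk_contract_l. Qed.

Let contract2D : {morph contract2 : x y / x + y}.
Proof. by move=> x y; rewrite /contract2 tmap_contractD dk_contractD. Qed.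

Let contract2E c a y : contract2 (tens dkr (tlact dkl) (tens rC lA c a) y)
  = tens rC (tlact lC) c (act a (contract y)).
Proof.
rewrite /contract2 tmap_tens //; first by rewrite dk_contract_tens.
exact: dk_contract_l.
Qed.

(** Expanding twice is a left inverse. Coassociativity of an expanded coaction can therefore be
    checked in C (x)_R C (x)_R M. *)
Let contract2_inj : injective contract2.
Proof.
apply: (can_inj (g := fun y => tmap dkr (tlact dkl) id expand
  (@dk_expand _ act (tlact lC) y))) => z.
rewrite /contract2 dk_contractK //; move: z.
have eD : {morph (tmap dkr (tlact dkl) id expand : tensor dkr act -> _) :
    x y / x + y} by apply: tmapD => // *; exact: dk_expand_l.
apply: tensor_ext => [x y|//|x y]; first by rewrite tmap_contractD eD.
rewrite !tmap_tens //.
- by rewrite /expand /contract dk_contractK.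
- exact: dk_expand_l.
- exact: dk_contract_l.
Qed.

(** Both sides send (c (x) a) (x) m to c_(1) (x) (c_(2) (x) a m). This matches one side of the two
    coassociativity laws; [contract2_rho] matches the other. *)
Lemma contract2_delta z :
  contract2 (tassoc (tmap (tract dkr) l (@dk_delta k R H A C) id z))
  = tassoc (tmap (tract rC) lR dC id (contract z)).
Proof.
have aD : {morph @tassoc _ _ _ _ _ dkr dkl dkr l : x y / x + y}.
  by apply: tassocD => // *; first [exact: dk_rD|rewrite dkrl].
have aD' : {morph @tassoc _ _ _ _ _ rC lC rC lR : x y / x + y}.
  exact: tassocD.
have dD : {morph (tmap (tract dkr) l (@dk_delta k R H A C) id :
    tensor dkr l -> _) : x y / x + y}.
  by apply: tmapD => //; first [exact: dk_deltaD|exact: dk_delta_r].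
have dD' : {morph (tmap (tract rC) lR dC id : tensor rC lR -> _) : x y / x + y}.
  exact: tmapD.
move: z; apply: dk_tensor_ext => [x y|x y|c a m].
- by rewrite dD aD contract2D.
- by rewrite contractD dD' aD'.
rewrite contractE !tmap_tens //; try first [exact: dk_deltaD|exact: dk_delta_r].
rewrite dk_delta_tens; move: (dC c); apply: tensor_ext => [x y|x y|c1 c2].
- by rewrite tensDl dk_splitD tensDl aD contract2D.
- by rewrite tensDl aD'.
rewrite dk_split_tens !tassoc_tens.
all: try by move=> *; first [exact: dklD|exact: dk_rD|exact: lCD|exact: rCD
                             |exact: lCrC|rewrite dkrl].
by rewrite contract2E contractE (lmod1 actM).
Qed.

(** The left side sends (c (x) a) (x) m to c (x) a contract(rho(m)), and linearity of rho and of the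
    contraction moves a inside to give contract(rho(a m)). *)
Lemma contract2_rho (rho : M -> tensor dkr l) z :
  {morph rho : x y / x + y} -> (forall a m, rho (l a m) = tlact dkl a (rho m)) ->
  contract2 (tmap dkr (tlact dkl) id rho z)
  = tmap rC (tlact lC) id (contract \o rho) (contract z).
Proof.
move=> rD rl.
have crD : {morph contract \o rho : x y / x + y}.
  by move=> x y /=; rewrite rD contractD.
have crl r m : (contract \o rho) (lR r m) = tlact lC r ((contract \o rho) m).
  by rewrite /= lRE rl dk_contract_l actRE.
move: z; apply: dk_tensor_ext => [x y|x y|c a m].
- by rewrite tmapD // contract2D.
- by rewrite contractD tmapD.
by rewrite contractE !tmap_tens // contract2E /= rl dk_contract_l.
Qed.

(** On (c (x) a) (x) m both sides are s_A(eps_C(c)) a m, so the two counit laws correspond. *)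
Lemma contract_counit z :
  tlunit (tmap *%R l (@dk_eps k R H A C) id z)
  = tlunit (tmap *%R lR eC id (contract z)).
Proof.
have b : balanced *%R l l.
  by split=> *; rewrite ?(lmodDl lM) ?(lmodDr lM) ?(lmodM lM).
move: z; apply: dk_tensor_ext => [x y|x y|c a m].
- rewrite tmapD ?tlunitD //; first [exact: dk_epsD|exact: dk_eps_r].
- by rewrite contractD epsMD.
rewrite contractE epsM // tmap_tens //; try first [exact: dk_epsD|exact: dk_eps_r].
by rewrite tlunit_tens // dk_eps_tens lRE (lmodM lM).
Qed.

Lemma contract_comodule (rho : M -> tensor dkr l) :
  @is_comodule k A (dk_coring A C) M l rho ->
  @is_comodule k R (mc_coring C) M lR (contract \o rho) /\
  forall a m, contract (rho (l a m)) = act a (contract (rho m)).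
Proof.
case=> _ /= rD rl ra rc.
have cl a m : contract (rho (l a m)) = act a (contract (rho m)).
  by rewrite rl dk_contract_l.
split=> //; split=> //= [m n|r m|m|m].
- by rewrite rD contractD.
(* R-linearity of the contracted coaction is its A-compatibility at a = s_A(r). *)
- by rewrite lRE cl -actRE.
- by rewrite -contract2_delta ra contract2_rho.
- by rewrite -contract_counit rc.
Qed.

Lemma expand_comodule (rho : M -> tensor rC lR) :
  @is_comodule k R (mc_coring C) M lR rho ->
  (forall a m, rho (l a m) = act a (rho m)) ->
  @is_comodule k A (dk_coring A C) M l (expand \o rho).
Proof.
case=> _ /= rD _ ra rc rl.
have eD : {morph expand \o rho : x y / x + y}.
  by move=> x y /=; rewrite rD expandD.
have el a m : (expand \o rho) (l a m) = tlact dkl a ((expand \o rho) m).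
  by rewrite /= rl dk_expand_l.
have ceK x : contract (expand x) = x by rewrite /contract /expand dk_expandK.
split=> //= m.
(* After double contraction the two sides become those of coassociativity of rho, since contracting
   the expanded coaction returns rho. *)
- apply: contract2_inj.
  rewrite -[LHS]/(contract2 (tassoc (tmap (tract dkr) l (@dk_delta k R H A C) id
     (expand (rho m))))) contract2_delta ceK ra.
  rewrite -[RHS]/(contract2 (tmap dkr (tlact dkl) id (expand \o rho)
     (expand (rho m)))) contract2_rho // ceK.
  by congr tmap; apply/funext => x /=; rewrite ceK.
- by rewrite contract_counit ceK rc.
Qed.

End Comodules.

(** * C (x)_R A as a Doi-Koppinen module *)

Let J (a : A) (u : tensor rC lC) : tensor rC (tlact lC) :=
  tassoc (tens (@tract _ _ _ _ rC lC rC) lA u a).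

Let assocD (N : zmodType) (lN : R -> N -> N) :
  {morph @tassoc _ _ _ _ _ rC lC rC lN : x y / x + y}.
Proof. exact: tassocD. Qed.

Let assocE (N : zmodType) (lN : R -> N -> N) c c' n :
  tassoc (tens (@tract _ _ _ _ rC lC rC) lN (tens rC lC c c') n)
  = tens rC _ c (tens rC lN c' n).
Proof. exact: tassoc_tens. Qed.

Let JE a c c' : J a (tens rC lC c c') = tens rC (tlact lC) c (tens rC lA c' a).
Proof. exact: assocE. Qed.

Let JD a : {morph J a : u v / u + v}.
Proof. by move=> u v; rewrite /J tensDl assocD. Qed.

Let lC_tD (N : zmodType) (lN : R -> N -> N) r :
  {morph (tlact lC r : tensor rC lN -> _) : x y / x + y}.
Proof. exact: tlactD. Qed.

Let Jl a r u : J a (tlact lC r u) = tlact lC r (J a u).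
Proof.
move: u; apply: tensor_ext => [x y|x y|c c'].
- by rewrite lC_tD JD.
- by rewrite JD lC_tD.
- by rewrite tlact_lC_tens !JE tlact_lC_tens.
Qed.

(** Delta_C (x) A, rebracketed to the right so that it is a coaction on the module C (x)_R A. *)
Definition free_rho (x : dk_car A C) : tensor rC (tlact lC) :=
  tassoc (tmap (tract rC) lA dC id x).

Lemma free_rho_tens c a : free_rho (tens rC lA c a) = J a (dC c).
Proof. by rewrite /free_rho tmap_tens. Qed.

Lemma free_rhoD : {morph free_rho : x y / x + y}.
Proof. by move=> x y; rewrite /free_rho tmapD ?assocD. Qed.

Let free_rho_lC r x : free_rho (tlact lC r x) = tlact lC r (free_rho x).
Proof.
move: x; apply: tensor_ext => [x y|x y|c a].
- by rewrite lC_tD free_rhoD.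
- by rewrite free_rhoD lC_tD.
- by rewrite tlact_lC_tens !free_rho_tens dCl Jl.
Qed.

Let free_rho_coassoc x :
  tassoc (tmap (tract rC) (tlact lC) dC id (free_rho x))
  = tmap rC (tlact lC) id free_rho (free_rho x).
Proof.
have tD : {morph (tmap (tract rC) (tlact lC) dC id :
    tensor rC (@tlact _ _ _ _ lC rC lA) -> _) : x y / x + y} by exact: tmapD.
have tD' : {morph (tmap rC (tlact lC) id free_rho :
    tensor rC (@tlact _ _ _ _ lC rC lA) -> _) : x y / x + y}.
  by apply: tmapD => //; exact: free_rhoD.
move: x; apply: tensor_ext => [x y|x y|c a].
- by rewrite free_rhoD tD assocD.
- by rewrite free_rhoD tD'.
rewrite free_rho_tens.
(* [K] attaches a to the last factor of C (x) C (x) C; the two sides of the goal are [K] applied to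
   the two sides of coassociativity of Delta_C at c. *)
pose K : tensor rC (tlact lC) -> tensor rC (tlact lC) :=
  tmap rC (tlact lC) id (J a).
have KD : {morph K : x y / x + y} by apply: tmapD => //; exact: JD.
have KE d u : K (tens rC _ d u) = tens rC _ d (J a u).
  by apply: tmap_tens => //; exact: JD.
transitivity (K (tassoc (tmap (tract rC) lC dC id (dC c)))).
  have sD : {morph (tmap (tract rC) lC dC id : tensor rC lC -> _) :
    x y / x + y} by exact: tmapD.
  move: (dC c); apply: tensor_ext => [x y|x y|c1 c2].
  - by rewrite JD tD assocD.
  - by rewrite sD assocD KD.
  rewrite JE !tmap_tens //; move: (dC c1).
  apply: tensor_ext => [x y|x y|d e].
  - by rewrite tensDl assocD.
  - by rewrite tensDl assocD KD.
  - by rewrite !assocE KE JE.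
have -> : tassoc (tmap (tract rC) lC dC id (dC c))
  = tmap rC (tlact lC) id dC (dC c) by exact: (cor_coassoc (mc_is_coring C)).
have sD : {morph (tmap rC (tlact lC) id dC : tensor rC lC -> _) :
  x y / x + y} by exact: tmapD.
move: (dC c); apply: tensor_ext => [x y|x y|c1 c2].
- by rewrite sD KD.
- by rewrite JD tD'.
- rewrite JE !tmap_tens //; last exact: free_rhoD.
  by rewrite KE free_rho_tens.
Qed.

Let lCM : is_lmodule lC.
Proof. exact: (bimod_l (cor_bimod (mc_is_coring C))). Qed.

Let tlact_lCM : is_lmodule (@tlact _ _ _ _ lC rC lA).
Proof. by apply: restrict_lmodule dklM _ => r x; rewrite dk_l_src. Qed.

Let free_rho_counit x : tlunit (tmap *%R (tlact lC) eC id (free_rho x)) = x.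
Proof.
move: x; apply: tensor_ext => [x y|//|c a].
- by rewrite free_rhoD epsMD.
rewrite free_rho_tens.
transitivity (tens rC lA (tlunit (tmap *%R lC eC id (dC c))) a).
  move: (dC c); apply: tensor_ext => [x y|x y|c1 c2].
  - by rewrite JD epsMD.
  - by rewrite epsMD // tensDl.
  - by rewrite JE !epsM // tlact_lC_tens.
by congr tens; exact: (cor_counitl (mc_is_coring C)).
Qed.

Lemma free_rho_comodule : @is_comodule k R (mc_coring C) _ (tlact lC) free_rho.
Proof. by split=> // *; rewrite free_rhoD. Qed.

(** Compatibility of Delta_C (x) A with the A-action: H-linearity of Delta_C produces the coproduct
    of a_<-1>, which coassociativity of the coaction of A turns into an iterated coaction. *)
Lemma free_rho_l a x :
  free_rho (dkl a x) = @dk_act _ dkl (tlact lC) a (free_rho x).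
Proof.
have evD := tak_evalD modC modA rCE lAE.
have evE := tak_eval_tens modC modA rCE lAE.
have evD' := tak_evalD modC dklM rCE lC_src.
have evE' := tak_eval_tens modC dklM rCE lC_src.
have evDC := tak_evalD modC modC rCE lCE.
have evEC := tak_eval_tens modC modC rCE lCE.
have aD := dk_actD dklM lC_src a.
move: x; apply: tensor_ext => [x y|x y|c b].
- by rewrite dklD free_rhoD.
- by rewrite free_rhoD aD.
(* With Delta c = sum c1 (x) c2, both sides are the sum of the E c1 c2 applied to
   one of the two sides of the coassociativity of the coaction of A at a. *)
pose E (c1 c2 : C) : tensor rH (@tlact _ _ _ _ lH rH lA) -> tensor rC (tlact lC) :=
  tmap rC (tlact lC) (fun h : H => h *: c1)
    (tak_eval *:%R *%R rC lA c2 b : tensor rH lA -> tensor rC lA).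
have lH_tE r h d : tlact lH r (tens rH lA h d) = tens rH lA (lH r h) d.
  exact: tlact_tens.
have lH_tD r : {morph (tlact lH r : tensor rH lA -> _) : x y / x + y}.
  exact: tlactD.
have fD (c1 : C) : {morph (fun h : H => h *: c1) : x y / x + y}.
  by move=> x y; rewrite scalerDl.
have fr (c1 : C) h s : rH h s *: c1 = rC (h *: c1) s.
  by rewrite /rH /tgt_r -scalerA.
have gl (c2 : C) s (w : tensor rH lA) :
    tak_eval *:%R *%R rC lA c2 b (tlact lH s w : tensor rH lA)
    = tlact lC s (tak_eval *:%R *%R rC lA c2 b w).
  move: w; apply: tensor_ext => [x y|x y|h d].
  - by rewrite lH_tD evD.
  - by rewrite evD lC_tD.
  - by rewrite lH_tE !evE tlact_lC_tens /lH /src_l -scalerA.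
have EE c1 c2 h w : E c1 c2 (tens rH _ h w)
    = tens rC _ (h *: c1) (tak_eval *:%R *%R rC lA c2 b w).
  by apply: tmap_tens => //; exact: evD.
have ED c1 c2 : {morph E c1 c2 : x y / x + y}.
  by apply: tmapD => //; exact: evD.
have dlE : forall d c', dkl d (tens rC lA c' b)
    = tak_eval *:%R *%R rC lA c' b (ca_rho d).
  by move=> d c'; apply: dk_act_tens.
have rhoD : {morph (@ca_rho _ _ _ A) : x y / x + y}.
  by move=> x y; exact: (tak_D (ca_rho_alg A)).
have rhol s d : ca_rho (lA s d) = tlact lH s (ca_rho d).
  exact: (comodl (ca_is_comodule A)).
have dHD : {morph (@bg_delta _ _ H) : x y / x + y}.
  by move=> x y; exact: (tak_D (bg_delta_alg H)).
have dHr h s : bg_delta (rH h s) = tract rH (bg_delta h) s.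
  exact: (cor_deltar (bg_is_coring H)).
have aHD : {morph @tassoc _ _ _ _ _ rH lH rH lA : x y / x + y}.
  exact: tassocD.
have aHE h h' n : tassoc (tens (@tract _ _ _ _ rH lH rH) lA (tens rH lH h h') n)
  = tens rH _ h (tens rH lA h' n).
  exact: tassoc_tens.
have mD : {morph (tmap (tract rH) lA (@bg_delta _ _ H) id : tensor rH lA -> _) :
    x y / x + y} by exact: tmapD.
have mD' : {morph (tmap rH (tlact lH) id (@ca_rho _ _ _ A) :
    tensor rH lA -> _) : x y / x + y} by exact: tmapD.
rewrite free_rho_tens dlE.
have JaD : {morph (fun u => @dk_act _ dkl (tlact lC) a (J b u)) : u v / u + v}.
  by move=> u v; rewrite JD aD.
(* A representative of Delta_C(c) is fixed, so that the inductions on the coaction of a run inside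
   one finite sum. *)
rewrite (tensor_morph_sum (dC c) JaD).
transitivity (\sum_(p <- tensor_repr (dC c))
    E p.1 p.2 (tassoc (tmap (tract rH) lA (@bg_delta _ _ H) id (ca_rho a)))).
  move: (ca_rho a); apply: tensor_ext => [x y|x y|h d].
  - by rewrite evD free_rhoD.
  - by rewrite -big_split; apply: eq_bigr => p _; rewrite mD aHD ED.
  (* As Delta_H(h) lies in the Takeuchi product, its action on C (x) C is additive, and Delta_C(h c)
     can be computed on the same representative of Delta_C(c). *)
  have dHt : in_takeuchi (bg_delta h) by exact: (tak_im (bg_delta_alg H)).
  have tD := tak_actD modC modC rCE lCE dHt.
  have JtD : {morph (fun u : tensor rC lC =>
      J (d * b) (tact *:%R *:%R (bg_delta h) u)) : u v / u + v}.
    by move=> u v; rewrite tD JD.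
  rewrite evE free_rho_tens [dC (h *: c)](mc_deltaZ h c).
  rewrite (tensor_morph_sum (dC c) JtD); apply: eq_bigr => -[c1 c2] _ /=.
  rewrite tak_act_tens // tmap_tens //.
  move: (bg_delta h); apply: tensor_ext => [x y|x y|h1 h2].
  - by rewrite evDC JD.
  - by rewrite tensDl aHD ED.
  - by rewrite evEC JE aHE EE evE.
apply: eq_bigr => -[c1 c2] _ /=; rewrite JE dk_act_tens //.
have -> : tassoc (tmap (tract rH) lA (@bg_delta _ _ H) id (ca_rho a))
    = tmap rH (tlact lH) id (@ca_rho _ _ _ A) (ca_rho a).
  exact: (comod_coassoc (ca_is_comodule A)).
move: (ca_rho a); apply: tensor_ext => [x y|x y|h d].
- by rewrite mD' ED.
- by rewrite evD'.
- by rewrite tmap_tens // EE evE' dlE.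
Qed.

(** * The coring axioms of C (x)_R A *)

Lemma dk_deltaE x :
  @dk_delta k R H A C x = @dk_expand _ dkl (tlact lC) (free_rho x).
Proof.
have eD := dk_expandD lC_src.
move: x; apply: tensor_ext => [x y|x y|c a]; first exact: dk_deltaD.
  by rewrite free_rhoD eD.
rewrite dk_delta_tens free_rho_tens.
move: (dC c); apply: tensor_ext => [x y|x y|c1 c2].
- by rewrite tensDl dk_splitD.
- by rewrite JD eD.
- by rewrite dk_split_tens JE dk_expand_tens.
Qed.

Lemma dk_delta_comodule :
  @is_comodule k A (dk_coring A C) _ dkl (@dk_delta k R H A C).
Proof.
have -> : @dk_delta k R H A C = @dk_expand _ dkl (tlact lC) \o free_rho.
  by apply/funext => x; rewrite /= dk_deltaE.
exact: (expand_comodule dklM lC_src free_rho_comodule free_rho_l).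
Qed.

(** The counit law of A at b s_A(r), with r = eps_C(c), reads s_A(eps_H(b_<-1> s_H(r))) b_<0> = b
    s_A(r), because s_A(r) has coaction s_H(r) (x) 1; and eps_H(h s_H(r)) is eps_C(h c). *)
Lemma dk_eps_l b x : @dk_eps k R H A C (dkl b x) = b * dk_eps x.
Proof.
have evD := tak_evalD modC modA rCE lAE.
have evE := tak_eval_tens modC modA rCE lAE.
have evDH := tak_evalD modH modA rHE lAE.
have evEH := tak_eval_tens modH modA rHE lAE.
move: x; apply: tensor_ext => [x y|x y|c a].
- by rewrite dklD dk_epsD.
- by rewrite dk_epsD mulrDr.
rewrite dk_eps_tens mulrA.
have <- := comod_counit (ca_is_comodule A) (b * sA (eC c)).
rewrite (tak_M (ca_rho_alg A)) ca_rho_src tak_act_tens //; last first.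
  exact: (tak_im (ca_rho_alg A)).
rewrite [dkl _ _]dk_act_tens //.
pose K (v : tensor rH lA) := tlunit (tmap *%R lA (@bg_eps _ _ H) id v).
have eHD : {morph @bg_eps _ _ H : x y / x + y}.
  by move=> x y; exact: (cor_epsD (bg_is_coring H)).
have eHr h s : bg_eps (rH h s) = bg_eps h * s.
  exact: (cor_epsr (bg_is_coring H)).
have bA : balanced *%R lA lA.
  by split=> *; rewrite ?(lmodDl lAM) ?(lmodDr lAM) ?(lmodM lAM).
have KD : {morph K : x y / x + y}.
  by move=> x y; rewrite /K tmapD // tlunitD.
have KE h d : K (tens rH lA h d) = sA (bg_eps h) * d.
  by rewrite /K tmap_tens // tlunit_tens.
rewrite -[tlunit _]/(K _).
move: (ca_rho b); apply: tensor_ext => [x y|x y|h d].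
- by rewrite evD dk_epsD.
- by rewrite evDH KD mulrDl.
rewrite evE evEH dk_eps_tens KE mulr1 mulrA.
by congr (sA _ * _ * _); exact: (mc_epsZ h c).
Qed.

(** This law does not come from the comodule axioms. On c (x) a the left side is c_(1) (x)
    s_A(eps_C(c_(2))) a; moving the scalar over R reduces it to the right counit law of C. *)
Lemma dk_counitr x :
  trunit (tmap dkr *%R id (@dk_eps k R H A C) (@dk_delta k R H A C x)) = x.
Proof.
have rM := bimod_r dk_bimodule.
have b : balanced dkr *%R dkr.
  by split=> *; rewrite ?(rmodDl rM) ?(rmodDr rM) ?(rmodM rM).
have CrM := bimod_r (cor_bimod (mc_is_coring C)).
have bC : balanced rC *%R rC.
  by split=> *; [exact: (rmodDl CrM)|exact: (rmodDr CrM)|exact/esym/(rmodM CrM)].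
have eD : {morph @dk_eps k R H A C : x y / x + y} by exact: dk_epsD.
have el c y : dk_eps (dkl c y) = c * dk_eps y by exact: dk_eps_l.
have tD : {morph (tmap dkr *%R id (@dk_eps k R H A C) : tensor dkr dkl -> _) :
    x y / x + y} by exact: tmapD.
have eCD : {morph eC : x y / x + y}.
  by move=> y z; exact: (cor_epsD (mc_is_coring C)).
have eCl r c : eC (lC r c) = r * eC c by exact: (cor_epsl (mc_is_coring C)).
move: x; apply: tensor_ext => [x y|//|c a].
  by rewrite dk_deltaD tD trunitD.
rewrite dk_delta_tens.
transitivity (tens rC lA (trunit (tmap rC *%R id eC (dC c))) a); last first.
  by congr tens; exact: (cor_counitr (mc_is_coring C)).
move: (dC c); apply: tensor_ext => [x y|x y|c1 c2].
- by rewrite tensDl dk_splitD tD trunitD.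
- by rewrite tmapD // trunitD // tensDl.
rewrite dk_split_tens !tmap_tens // !trunit_tens // dk_eps_tens dk_r_tens mul1r.
by rewrite tens_bal.
Qed.

Lemma dk_coring_is_coring : is_coring (dk_coring A C).
Proof.
case: dk_delta_comodule => _ /= dD dl da dc.
split=> //=.
- exact: dk_bimodule.
- exact: dk_delta_r.
- exact: dk_epsD.
- exact: dk_eps_l.
- exact: dk_eps_r.
- exact: dk_counitr.
Qed.

(** * The natural isomorphism from (C (x)_R A) (x)_A (C (x)_R A) to C (x)_R C (x)_R A *)

Let join c : tensor rC lA -> tensor (@tract _ _ _ _ rC lC rC) lA :=
  tlift (fun c' a => tens _ lA (tens rC lC c c') a).

Let join_balanced c : balanced rC lA
  (fun c' a => tens (@tract _ _ _ _ rC lC rC) lA (tens rC lC c c') a).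
Proof.
split=> [d d' a|d a a'|d r a]; rewrite ?tensDr ?tensDl //.
by rewrite -tract_rC_tens tens_bal.
Qed.

Let joinE c c' a : join c (tens rC lA c' a) = tens _ lA (tens rC lC c c') a.
Proof. exact: tlift_tens (join_balanced c) _ _. Qed.

Let joinD c : {morph join c : x y / x + y}.
Proof. exact: tliftD (join_balanced c). Qed.

Let joinDl c d y : join (c + d) y = join c y + join d y.
Proof.
move: y; apply: tensor_ext => [x y|x y|c' a]; rewrite ?joinD //.
  by rewrite addrACA.
by rewrite !joinE !tensDl.
Qed.

Let joinr c r y : join (rC c r) y = join c (tlact lC r y).
Proof.
move: y; apply: tensor_ext => [x y|x y|c' a]; rewrite ?lC_tD ?joinD //.
by rewrite tlact_lC_tens !joinE tens_bal.
Qed.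

Let merge_inner_balanced y : balanced rC lA (fun c a => join c (dkl a y)).
Proof.
split=> [c d a|c a b|c r a]; rewrite ?joinDl //.
  by rewrite (lmodDl dklM) joinD.
by rewrite joinr -dk_l_src -(lmodM dklM).
Qed.

Let merge1 y : tensor rC lA -> tensor (@tract _ _ _ _ rC lC rC) lA :=
  tlift (fun c a => join c (dkl a y)).

Let merge1E y c a : merge1 y (tens rC lA c a) = join c (dkl a y).
Proof. exact: tlift_tens (merge_inner_balanced y) _ _. Qed.

Let merge1D y : {morph merge1 y : u v / u + v}.
Proof. exact: tliftD (merge_inner_balanced y). Qed.

Let merge_balanced : balanced dkr dkl (fun x y => merge1 y x).
Proof.
split=> [u v y|u x y|u b y]; first exact: merge1D.
- move: u; apply: tensor_ext => [u v|u v|c a]; rewrite ?merge1D //.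
    by rewrite addrACA.
  by rewrite !merge1E dklD joinD.
- move: u; apply: tensor_ext => [u v|u v|c a]; rewrite ?dk_rD ?merge1D //.
  by rewrite dk_r_tens !merge1E (lmodM dklM).
Qed.

Lemma dk_merge_tens c a y :
  @dk_merge k R H A C (tens dkr dkl (tens rC lA c a) y) = join c (dkl a y).
Proof. by rewrite -merge1E; exact: (tlift_tens merge_balanced). Qed.

Lemma dk_mergeD : {morph @dk_merge k R H A C : x y / x + y}.
Proof. exact: (tliftD merge_balanced). Qed.

(** Merging and splitting sends (c (x) a) (x) y to (c (x) 1) (x) a y, which equals the original by
    balancing over A. *)
Lemma dk_mergeK : cancel (@dk_merge k R H A C) (@dk_split k R H A C).
Proof.
have sj c y : dk_split (join c y) = tens dkr dkl (tens rC lA c 1) y.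
  move: y; apply: tensor_ext => [x y|x y|c' a].
  - by rewrite joinD dk_splitD.
  - by rewrite tensDr.
  - by rewrite joinE dk_split_tens.
apply: tensor_ext => [x y|//|x y]; first by rewrite dk_mergeD dk_splitD.
move: x; apply: tensor_ext => [u v|u v|c a].
- by rewrite tensDl dk_mergeD dk_splitD.
- by rewrite tensDl.
- by rewrite dk_merge_tens sj -tens_bal dk_r_tens mul1r.
Qed.

Lemma dk_splitK : cancel (@dk_split k R H A C) (@dk_merge k R H A C).
Proof.
apply: tensor_ext => [x y|//|x a]; first by rewrite dk_splitD dk_mergeD.
move: x; apply: tensor_ext => [u v|u v|c c'].
- by rewrite tensDl dk_splitD dk_mergeD.
- by rewrite tensDl.
- by rewrite dk_split_tens dk_merge_tens (lmod1 dklM) joinE.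
Qed.

End DoiKoppinen.

(** * The isomorphism of categories *)

(** Isomorphism of categories is strict, so a morphism and its image have to be compared across
    propositional equalities of objects. *)
Definition cast_hom (D : category) (X X' Y Y' : D) (eX : X = X') (eY : Y = Y') :
    Defs.hom X Y -> Defs.hom X' Y' :=
  let: erefl := eX in let: erefl := eY in id.

Lemma functor_id_eq (D : category) (K : functor D D) (eK : forall X, K X = X) :
  (forall X Y (f : Defs.hom X Y), cast_hom (eK X) (eK Y) (fhom K f) = f) ->
  K = functor_id D.
Proof.
case: K eK => o h h1 hc /= eK.
have eo : o = id by apply/funext.
move: eo h h1 hc eK => -> h h1 hc eK hE.
have eh : h = fun _ _ => id.
  apply: functional_extensionality_dep => X.
  apply: functional_extensionality_dep => Y.
  apply/funext => f; rewrite -[RHS](hE X Y f).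
  (* Both equalities now relate an object to itself, so by proof irrelevance the transport is
     trivial. *)
  by rewrite (Prop_irrelevance (eK X) erefl) (Prop_irrelevance (eK Y) erefl).
move: eh h1 hc {hE} => -> h1 hc; rewrite /functor_id.
by congr Functor; exact: Prop_irrelevance.
Qed.

(** * Equality of objects on the same module, and transport of their morphisms *)

Section ComoduleEquality.
Variables (k : comPzRingType) (B : kalgebra k) (C : coring_data B).

Lemma comodule_eq (M : lmodType B)
    (r r' : M -> tensor (@cor_r _ _ C) *:%R) p p' :
  r = r' -> @Comodule k B C M r p = @Comodule k B C M r' p'.
Proof. by move=> e; move: e p p' => -> p p'; rewrite (Prop_irrelevance p p'). Qed.

(** The objects differ only in coactions and axioms, so transport leaves the underlying function
    alone. The equalities are arbitrary; once the coactions are identified they become loops, which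
    proof irrelevance removes. *)
Lemma comodule_cast_hom (M N : lmodType B)
    (r r' : M -> tensor (@cor_r _ _ C) *:%R)
    (s s' : N -> tensor (@cor_r _ _ C) *:%R) p p' q q'
    (eM : @Comodule k B C M r p = @Comodule k B C M r' p')
    (eN : @Comodule k B C N s q = @Comodule k B C N s' q')
    (f : comodule_hom (@Comodule k B C M r p) (@Comodule k B C N s q))
    (g : comodule_hom (@Comodule k B C M r' p') (@Comodule k B C N s' q')) :
  r = r' -> s = s' -> (forall x, f x = g x) ->
  @cast_hom (comodule_cat C) _ _ _ _ eM eN f = g.
Proof.
move=> er es; move: er es p p' q q' eM eN f g => -> -> p p' q q'.
rewrite (Prop_irrelevance p' p) (Prop_irrelevance q' q) => eM eN f g fg.
rewrite (Prop_irrelevance eM erefl) (Prop_irrelevance eN erefl).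
exact: comodule_homP.
Qed.
End ComoduleEquality.

Section DoiKoppinenEquality.
Variables (k : comPzRingType) (R : kalgebra k) (H : bialgebroid R).
Variables (A : comodule_algebra H) (C : module_coalgebra H).
Notation T M := (tensor (@res_r k R H C (bg_t H)) (@res_l k R A M (ca_s A))).

Lemma dk_module_eq (M : lmodType A) (r r' : M -> T M) p p' l l' :
  r = r' -> @DKModule k R H A C M r p l = @DKModule k R H A C M r' p' l'.
Proof.
move=> e; move: e p p' l l' => -> p p' l l'.
by rewrite (Prop_irrelevance p p') (Prop_irrelevance l l').
Qed.

Lemma dk_cast_hom (M N : lmodType A) (r r' : M -> T M) (s s' : N -> T N)
    p p' q q' l l' t t'
    (eM : @DKModule k R H A C M r p l = @DKModule k R H A C M r' p' l')
    (eN : @DKModule k R H A C N s q t = @DKModule k R H A C N s' q' t')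
    (f : dk_hom (@DKModule k R H A C M r p l) (@DKModule k R H A C N s q t))
    (g : dk_hom (@DKModule k R H A C M r' p' l')
                (@DKModule k R H A C N s' q' t')) :
  r = r' -> s = s' -> (forall x, f x = g x) ->
  @cast_hom (dk_cat A C) _ _ _ _ eM eN f = g.
Proof.
move=> er es; move: er es p p' q q' l l' t t' eM eN f g.
move=> -> -> p p' q q' l l' t t'.
rewrite (Prop_irrelevance p' p) (Prop_irrelevance q' q).
rewrite (Prop_irrelevance l' l) (Prop_irrelevance t' t) => eM eN f g fg.
rewrite (Prop_irrelevance eM erefl) (Prop_irrelevance eN erefl).
exact: dk_homP.
Qed.
End DoiKoppinenEquality.

(** * The two functors and their composites *)

Section Isomorphism.
Variables (k : comPzRingType) (R : kalgebra k) (H : bialgebroid R).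
Variables (A : comodule_algebra H) (C : module_coalgebra H).

Notation lR M := (@res_l k R A M (ca_s A)).
Notation rC := (@res_r k R H C (bg_t H)).
Notation contract M := (@dk_contract k R H A C M *:%R (lR M)).
Notation expand M := (@dk_expand k R H A C M *:%R (lR M)).
Notation rAC := (@dk_r k R H A C).

Let scM (M : lmodType A) := scale_lmodule M.
Let lRE (M : lmodType A) r (m : M) : lR M r m = ca_s A r *: m.
Proof. by []. Qed.

(** Linearity gives c (x) a f(m) = c (x) f(a m). Through this naturality, colinearity over C (x)_R A
    and over C become the same condition on f. *)
Lemma dk_contract_natural (M N : lmodType A) (f : M -> N) z : linear f ->
  contract N (tmap rAC *:%R id f z) = tmap rC (lR N) id f (contract M z).
Proof.
move=> fL.
have fD : {morph f : x y / x + y}.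
  by move=> x y; have := fL 1 x y; rewrite !scale1r.
have f0 : f 0 = 0 by apply: (@addIr _ (f 0)); rewrite -fD !add0r.
have fZ a x : f (a *: x) = a *: f x by have := fL a x 0; rewrite f0 !addr0.
have fr r m : f (lR M r m) = lR N r (f m) by exact: fZ.
have cD (L : lmodType A) : {morph contract L : x y / x + y}.
  by apply: dk_contractD => //; exact: scM.
have cE (L : lmodType A) c a (m : L) :
    contract L (tens rAC *:%R (tens rC (src_l (ca_s A)) c a) m)
    = tens rC (lR L) c (a *: m).
  by apply: dk_contract_tens => //; exact: scM.
move: z; apply: dk_tensor_ext => [x y|x y|c a m].
- by rewrite tmapD // cD.
- by rewrite cD tmapD.
- by rewrite cE !tmap_tens // cE fZ.
Qed.

Section ToDK.
Variable M : comodule (dk_coring A C).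

Let conv := contract_comodule (scM M) (@lRE M) (com_is_comodule M).

Definition dk_of_comodule : dk_module A C :=
  @DKModule k R H A C M (contract M \o com_rho (c:=M)) conv.1 conv.2.
End ToDK.

Section OfDK.
Variable M : dk_module A C.

Definition comodule_of_dk : comodule (dk_coring A C) :=
  @Comodule k A (dk_coring A C) M (expand M \o dk_rho (d:=M))
    (expand_comodule (scM M) (@lRE M) (dk_is_comodule M) (@dk_rhoZ _ _ _ _ _ M)).
End OfDK.

Fact dk_hom_of_colinear (M N : comodule (dk_coring A C))
    (f : comodule_hom M N) m :
  dk_rho (d:=dk_of_comodule N) (f m)
  = tmap rC (lR N) id f (dk_rho (d:=dk_of_comodule M) m).
Proof.
rewrite /= comh_colinear; apply: dk_contract_natural; exact: comh_linear.
Qed.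

Definition dk_hom_of (M N : comodule (dk_coring A C)) (f : comodule_hom M N) :
    dk_hom (dk_of_comodule M) (dk_of_comodule N) :=
  @DKHom k R H A C (dk_of_comodule M) (dk_of_comodule N) f (comh_linear f)
    (dk_hom_of_colinear f).

Fact comodule_hom_of_colinear (M N : dk_module A C) (f : dk_hom M N) m :
  com_rho (c:=comodule_of_dk N) (f m)
  = tmap rAC *:%R id f (com_rho (c:=comodule_of_dk M) m).
Proof.
(* Contraction is injective, and contracting both sides turns the claim into C-colinearity of f. *)
apply: (can_inj (dk_contractK (scM N) (@lRE N))).
rewrite dk_contract_natural; last exact: dkh_linear.
by rewrite /= !dk_expandK // dkh_colinear.
Qed.

Definition comodule_hom_of (M N : dk_module A C) (f : dk_hom M N) :
    comodule_hom (comodule_of_dk M) (comodule_of_dk N) :=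
  @ComoduleHom k A (dk_coring A C) (comodule_of_dk M) (comodule_of_dk N) f
    (dkh_linear f) (comodule_hom_of_colinear f).

Definition comodule_to_dk : functor (comodule_cat (dk_coring A C)) (dk_cat A C).
Proof.
by refine (@Functor (comodule_cat (dk_coring A C)) (dk_cat A C)
  dk_of_comodule dk_hom_of _ _); move=> *; apply: dk_homP.
Defined.

Definition dk_to_comodule : functor (dk_cat A C) (comodule_cat (dk_coring A C)).
Proof.
by refine (@Functor (dk_cat A C) (comodule_cat (dk_coring A C))
  comodule_of_dk comodule_hom_of _ _); move=> *; apply: comodule_homP.
Defined.

Let rho_contractK (M : lmodType A) (r : M -> tensor rAC *:%R) :
  expand M \o (contract M \o r) = r.
Proof. by apply/funext => m /=; rewrite dk_contractK. Qed.

Let rho_expandK (M : lmodType A) (r : M -> tensor rC (lR M)) :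
  contract M \o (expand M \o r) = r.
Proof. by apply/funext => m /=; rewrite dk_expandK. Qed.

(** Each round trip keeps the module and the underlying functions, and composes the coaction with
    mutually inverse maps; object equality thus reduces to equality of coactions. *)
Lemma comodule_dk_isomorphic :
  isomorphic_categories (comodule_cat (dk_coring A C)) (dk_cat A C).
Proof.
exists comodule_to_dk, dk_to_comodule; split.
- have eK (X : comodule_cat (dk_coring A C)) :
    functor_comp dk_to_comodule comodule_to_dk X = X.
    by case: X => M r p; apply: comodule_eq; exact: rho_contractK.
  (* The object equalities are generalized before the objects are destructed, which brings the goal
     to the form of [comodule_cast_hom]. *)
  apply: (functor_id_eq (eK := eK)) => X Y f; move: (eK X) (eK Y).
  case: X Y f => M r p [N s q] f eX eY.
  by apply: comodule_cast_hom => //; exact: rho_contractK.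
- have eK (X : dk_cat A C) : functor_comp comodule_to_dk dk_to_comodule X = X.
    by case: X => M r p l; apply: dk_module_eq; exact: rho_expandK.
  apply: (functor_id_eq (eK := eK)) => X Y f; move: (eK X) (eK Y).
  case: X Y f => M r p l [N s q t] f eX eY.
  by apply: dk_cast_hom => //; exact: rho_expandK.
Qed.

End Isomorphism.

Theorem proposition4p1 (k : comPzRingType) (R : kalgebra k) (H : bialgebroid R)
    (A : comodule_algebra H) (C : module_coalgebra H) :
  is_bimodule (@dk_l k R H A C) (@dk_r k R H A C) /\
  (cancel (@dk_merge k R H A C) (@dk_split k R H A C) /\
   cancel (@dk_split k R H A C) (@dk_merge k R H A C)) /\
  is_coring (dk_coring A C) /\
  isomorphic_categories (comodule_cat (dk_coring A C)) (dk_cat A C).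
Proof.
split; first exact: dk_bimodule.
split; first by split; [exact: dk_mergeK|exact: dk_splitK].
by split; [exact: dk_coring_is_coring|exact: comodule_dk_isomorphic].
Qed.
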